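(* There exists a D$_0$ graph $\mathcal{G}^*$ (with vertex set contained in the set of permutations of $\{1,\dots,8\}$) satisfying axioms $4''b$ and $5$ whose generating function is not Schur positive. Hence D graphs do not always have Schur positive generating functions.
   Context: Words are in the alphabet $\{1,\dots,N\}$; $\mathcal{W}_n$ is the set of words of length $n$ with no repeated letter. A D$_0$ graph of degree $n$ is a graph on a vertex set $W\subseteq\mathcal{W}_n$ with edges colored from $\{2,\dots,n-1\}$ such that (i) each $i$-edge is one of the pairs $\{v\,bac\,w, v\,bca\,w\}$, $\{v\,acb\,w,v\,cab\,w\}$ (Knuth edges) or $\{v\,bac\,w,v\,acb\,w\}$, $\{v\,bca\,w,v\,cab\,w\}$ (rotation edges) for letters $a<b<c$ and words $v,w$ with $v$ of length $i-2$; (ii) for all letters $a<b<c$ and words $v,w$ with $v$ of length $i-2$, each element of $W\cap\{v\,bac\,w,v\,bca\,w,v\,acb\,w,v\,cab\,w\}$ belongs to exactly one $i$-edge. A D$_0$ graph is regarded as a signed, colored graph with signature $\sigma(w)_i=+1$ if $w_i<w_{i+1}$ and $-1$ otherwise ($i\in[n-1]$). A signed, colored graph of degree $n$ is a graph with vertex set $V$, edges colored from $\{2,\dots,n-1\}$, and a signature $\sigma:V\to\{\pm1\}^{n-1}$. Its generating function is $\sum_{v\in V}Q_{\mathrm{Des}(v)}(\mathbf{x})$, where $\mathrm{Des}(v)=\{i:\sigma(v)_i=-1\}$ and $Q_S(\mathbf{x})=\sum x_{i_1}\cdots x_{i_n}$ over $1\le i_1\le\cdots\le i_n$ with $i_j<i_{j+1}$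 for $j\in S$ (Gessel's fundamental quasisymmetric function); Schur positive means its Schur expansion has nonnegative coefficients. Axiom 0: every vertex lies on at most one $i$-edge for each $i$. Under axiom 0, $E_i(v)=w$ means $\{v,w\}$ is an $i$-edge; $v$ admits an $i$-neighbor if such $w$ exists; expressions $E_{i_1}\cdots E_{i_r}(v)$ used below are required to be defined. For an interval $K=\{i,\dots,j\}$, $\mathrm{Res}_K\mathcal{G}$ has vertex set $V$, signature $\hat\sigma(v)_s=\sigma(v)_{s+i-1}$ ($s\in[j-i]$), and an $(s-i+1)$-edge for each $s$-edge with $i+1\le s\le j-1$; $\mathrm{Res}_K(\mathcal{G},w)$ is its component containing $w$. LSP$_d$: every component of every $\mathrm{Res}_K\mathcal{G}$ with $|K|=d$ has Schur positive generating function. A vertex $v$ has $i$-type W if it admits an $i$-neighbor and an $(i-1)$-neighbor and $\sigma(v)_i=-\sigma(E_{i-1}(v))_i$. The $(i-2)$-$(i-1)$-string containing $x$ is the connected component of $x$ in the subgraph with only the $(i-2)$- and $(i-1)$-edges. For $4\le i<n$, a flat $i$-chain is a sequence $(x^1,\dots,x^{2h})$ of distinct vertices admitting $(i-2)$-neighbors with $x^{2j-1}=E_i(x^{2j})$ and $x^{2j+1}=E_{i-2}(E_{i-1}E_{i-2})^{m_j}(x^{2j})$ for nonnegative integers $m_j$ such that $(E_{i-1}E_{i-2})^{m_j}(x^{2j})$ does not have $(i-1)$-type W. A weak flat $i$-chain is the same except that $x^{2j+1}$ is any vertex of the $(i-2)$-$(i-1)$-string containing $x^{2j}$ such that $E_{i-2}(x^{2j+1})$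 does not have $(i-1)$-type W. Axioms: (1) axiom 0 holds and $w$ admits an $i$-neighbor iff $\sigma(w)_{i-1}=-\sigma(w)_i$; (2) for each $i$-edge $\{w,x\}$, $\sigma(w)_j=-\sigma(x)_j$ for $j=i-1,i$ and $\sigma(w)_h=\sigma(x)_h$ for $h<i-2$ and $h>i+1$; (3) for each $i$-edge $\{w,x\}$, if $\sigma(w)_{i-2}=-\sigma(x)_{i-2}$ then $\sigma(w)_{i-2}=-\sigma(w)_{i-1}$, and if $\sigma(w)_{i+1}=-\sigma(x)_{i+1}$ then $\sigma(w)_{i+1}=-\sigma(w)_i$; ($4'a$) for every $w$ admitting an $(i-1)$-neighbor $v$ with $\{w,v\}$ not an $i$-edge, $\sigma(w)_{i-3}\ne\sigma(v)_{i-3}$ and $\sigma(w)_i\ne\sigma(v)_i$, the generating functions of $\mathrm{Res}_{[i-3,i]}(\mathcal{G},w)$ and $\mathrm{Res}_{[i-2,i+1]}(\mathcal{G},w)$ are equal; ($4'b$) if $(x^1,\dots,x^{2h})$ is a flat $i$-chain and $x^j$ has $(i+1)$-type W for some $2<j<2h-1$, then $x^1,\dots,x^j$ all have $(i+1)$-type W or $x^j,\dots,x^{2h}$ all have $(i+1)$-type W; ($4''b$) the same as $4'b$ with weak flat $i$-chains in place of flat $i$-chains; (5) if $\{w,x\}$ is an $i$-edge and $\{x,y\}$ a $j$-edge with $|i-j|\ge 3$, there is $v$ with $\{w,v\}$ a $j$-edge and $\{v,y\}$ an $i$-edge. A D graph is a signed, colored graph satisfying axioms 1, 2, 3, $4'a$,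 $4'b$, 5, LSP$_4$ and LSP$_5$. *)

(* Defs.v *)
From HB Require Import structures.
From mathcomp Require Import all_boot all_order all_algebra.
From mathcomp Require Import mpoly.

Set Implicit Arguments.
Unset Strict Implicit.
Unset Printing Implicit Defensive.

Import GRing.Theory Num.Theory.
Local Open Scope ring_scope.

(** A formal power series of bounded degree in x_1, x_2, ... is represented by
    the family, indexed by m, of the polynomials obtained by setting x_k = 0
    for k > m; two such series are equal iff they agree for every m. *)

(* Positions 1, ..., n are the ordinals 0, ..., n-1, so S contains j.+1 when
   the 1-based position of j : 'I_n belongs to the set S. *)
Definition fundamental (n : nat) (S : pred nat) (m : nat) : {mpoly int[m]} :=
  \sum_(s : {ffun 'I_n -> 'I_m} |
          [forall j : 'I_n, forall k : 'I_n, (k == j.+1 :> nat) ==>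
             (if S j.+1 then s j < s k else s j <= s k)%N])
    \prod_(j < n) 'X_(s j).

(* Partitions of n are padded with zeros to length n. *)
Definition is_partition (n : nat) (la : {ffun 'I_n -> 'I_n.+1}) : bool :=
  [forall r : 'I_n, forall q : 'I_n, (r <= q)%N ==> (la q <= la r)%N]
  && ((\sum_(r < n) la r)%N == n).

Definition cell (n : nat) (la : {ffun 'I_n -> 'I_n.+1}) :=
  {x : 'I_n * 'I_n | (x.2 < la x.1)%N}.

Definition semistandard (n : nat) (la : {ffun 'I_n -> 'I_n.+1}) (m : nat)
    (T : {ffun cell la -> 'I_m}) : bool :=
  [forall x : cell la, forall y : cell la,
     (((val x).1 == (val y).1) && ((val x).2 < (val y).2)%N
        ==> (T x <= T y)%N)
  && (((val x).2 == (val y).2) && ((val x).1 < (val y).1)%N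
        ==> (T x < T y)%N)].

Definition schur (n : nat) (la : {ffun 'I_n -> 'I_n.+1}) (m : nat) :
    {mpoly int[m]} :=
  \sum_(T : {ffun cell la -> 'I_m} | semistandard T) \prod_(x : cell la) 'X_(T x).

Definition schur_positive (n : nat) (f : forall m, {mpoly int[m]}) : Prop :=
  exists c : {ffun 'I_n -> 'I_n.+1} -> int,
    (forall la, 0 <= c la) /\
    (forall m, f m = \sum_(la | is_partition la) c la *: schur la m).

(* [sgn v i] is true when sigma(v)_i = +1 and false when sigma(v)_i = -1; only
   the values at i = 1, ..., n-1 are meaningful, and no definition below depends
   on the others.  [edge i] is the set of i-edges, seen as a relation. *)
Record scgraph (n : nat) (V : finType) := SCGraph {
  sgn : V -> nat -> bool;
  edge : nat -> rel V;
  edge_sym : forall i v w, edge i v w = edge i w v;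
  edge_irr : forall i, irreflexive (edge i);
  edge_col : forall i v w, edge i v w -> (1 < i < n)%N }.

Section Graph.
Variables (n : nat) (V : finType).
Implicit Types (G : scgraph n V) (v w : V).

Definition des G v : pred nat := fun i => ~~ sgn G v i.

Definition genfun G (A : {set V}) (m : nat) : {mpoly int[m]} :=
  \sum_(v in A) fundamental n (des G v) m.

Definition component G w : {set V} :=
  [set v | connect (fun x y => [exists i : 'I_n, edge G i x y]) w v].

End Graph.

Section Restriction.
Variables (n : nat) (V : finType) (G : scgraph n V) (i d : nat).

Let redge (t : nat) : rel V :=
  fun x y => (1 < t < d)%N && edge G (t + i)%N.-1 x y.

Fact redge_sym t x y : redge t x y = redge t y x.
Proof. by rewrite /redge edge_sym. Qed.

Fact redge_irr t : irreflexive (redge t).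
Proof. by move=> x; rewrite /redge edge_irr andbF. Qed.

Fact redge_col t x y : redge t x y -> (1 < t < d)%N.
Proof. by case/andP. Qed.

(* Res_K G for the interval K = {i, ..., i + d - 1} with d elements. *)
Definition Res : scgraph d V :=
  SCGraph (fun v s => sgn G v (s + i)%N.-1) redge_sym redge_irr redge_col.

End Restriction.

Section Conditions.
Variables (n : nat) (V : finType).
Implicit Types (G : scgraph n V) (v w x y : V) (i j d : nat).

Definition graph_schur_positive G : Prop :=
  schur_positive n (genfun G [set: V]).

Definition LSP (d : nat) G : Prop :=
  forall i, (0 < i)%N -> (i + d <= n.+1)%N ->
  forall w, schur_positive d (genfun (Res G i d) (component (Res G i d) w)).

Definition admits G i v : bool := [exists w, edge G i v w].

(* The partial map E_i; the choice made by [pick] is unique under axiom 0. *)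
Definition E G i v : option V := [pick w | edge G i v w].

Definition typeW G i v : bool :=
  [&& admits G i v, admits G i.-1 v &
      if E G i.-1 v is Some u then sgn G v i == ~~ sgn G u i else false].

(* (E_{i-1} E_{i-2})^k (v), where E_{i-2} is applied first. *)
Definition EE G i k v : option V :=
  iter k (fun o => obind (E G i.-1) (obind (E G (i - 2)) o)) (Some v).

Definition string G i x : {set V} :=
  [set y | connect (fun u v => edge G (i - 2) u v || edge G i.-1 u v) x y].

(* The sequence (x^1, ..., x^{2h}) is given by the values x 1, ..., x (2 * h)
   of a function x : nat -> V; its other values are irrelevant. *)
Definition chain_base G i (h : nat) (x : nat -> V) : Prop :=
  [/\ forall j k, (0 < j <= 2 * h)%N -> (0 < k <= 2 * h)%N ->
        x j = x k -> j = k,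
      forall j, (0 < j <= 2 * h)%N -> admits G (i - 2) (x j) &
      forall j, (0 < j <= h)%N -> E G i (x (2 * j)%N) = Some (x (2 * j).-1)].

Definition flat_chain G i (h : nat) (x : nat -> V) : Prop :=
  chain_base G i h x /\
  forall j, (0 < j < h)%N -> exists k y,
    [/\ EE G i k (x (2 * j)%N) = Some y,
        ~~ typeW G i.-1 y &
        E G (i - 2) y = Some (x (2 * j).+1)].

Definition weak_flat_chain G i (h : nat) (x : nat -> V) : Prop :=
  chain_base G i h x /\
  forall j, (0 < j < h)%N ->
    x (2 * j).+1 \in string G i (x (2 * j)%N) /\
    exists2 y, E G (i - 2) (x (2 * j).+1) = Some y & ~~ typeW G i.-1 y.

Definition axiom0 G : Prop :=
  forall i v w x, edge G i v w -> edge G i v x -> w = x.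

Definition axiom1 G : Prop :=
  axiom0 G /\
  forall i w, (1 < i < n)%N -> admits G i w = (sgn G w i.-1 == ~~ sgn G w i).

Definition axiom2 G : Prop :=
  forall i w x, edge G i w x ->
    [/\ sgn G w i.-1 = ~~ sgn G x i.-1,
        sgn G w i = ~~ sgn G x i,
        forall h, (0 < h)%N -> (h < i - 2)%N -> sgn G w h = sgn G x h &
        forall h, (i.+1 < h)%N -> (h < n)%N -> sgn G w h = sgn G x h].

Definition axiom3 G : Prop :=
  forall i w x, edge G i w x ->
    ((0 < i - 2)%N -> sgn G w (i - 2) = ~~ sgn G x (i - 2) ->
       sgn G w (i - 2) = ~~ sgn G w i.-1) /\
    ((i.+1 < n)%N -> sgn G w i.+1 = ~~ sgn G x i.+1 ->
       sgn G w i.+1 = ~~ sgn G w i).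

(* The bounds on i say that sigma_{i-3} and sigma_i exist, equivalently that
   both intervals [i-3,i] and [i-2,i+1] are contained in [1,n]. *)
Definition axiom4'a G : Prop :=
  forall i w v, (0 < i - 3)%N -> (i < n)%N ->
    edge G i.-1 w v -> ~~ edge G i w v ->
    sgn G w (i - 3) <> sgn G v (i - 3) -> sgn G w i <> sgn G v i ->
    forall m,
      genfun (Res G (i - 3) 4) (component (Res G (i - 3) 4) w) m =
      genfun (Res G (i - 2) 4) (component (Res G (i - 2) 4) w) m.

Definition axiom4b_for G (chain : nat -> nat -> (nat -> V) -> Prop) : Prop :=
  forall (i h : nat) (x : nat -> V), (3 < i < n)%N -> chain i h x ->
  forall j, (2 < j)%N -> (j < 2 * h - 1)%N -> typeW G i.+1 (x j) ->
    (forall k, (0 < k <= j)%N -> typeW G i.+1 (x k)) \/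
    (forall k, (j <= k <= 2 * h)%N -> typeW G i.+1 (x k)).

Definition axiom4'b G : Prop := axiom4b_for G (flat_chain G).

Definition axiom4''b G : Prop := axiom4b_for G (weak_flat_chain G).

Definition axiom5 G : Prop :=
  forall i j w x y, edge G i w x -> edge G j x y ->
    (i + 3 <= j)%N || (j + 3 <= i)%N ->
    exists v, edge G j w v /\ edge G i v y.

Definition is_D_graph G : Prop :=
  [/\ axiom1 G, axiom2 G, axiom3 G & axiom4'a G] /\
  [/\ axiom4'b G, axiom5 G, LSP 4 G & LSP 5 G].

End Conditions.

(** The alphabet {1, ..., N} is rendered by 'I_N, the ordinal a standing for
    the letter a + 1; words of length n are n-tuples over 'I_N. *)

Section D0.
Variables (n N : nat).

(* w_i, with 1-based positions. *)
Definition letter (w : n.-tuple 'I_N) (i : nat) : nat :=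
  nth 0%N [seq val a | a <- w] i.-1.

Definition same_pair (x y p q : seq 'I_N) : Prop :=
  (x = p /\ y = q) \/ (x = q /\ y = p).

Definition knuth_or_rotation (i : nat) (x y : seq 'I_N) : Prop :=
  exists (v w : seq 'I_N) (a b c : 'I_N),
    [/\ (size v).+2 = i, (a < b)%N, (b < c)%N &
        let bac := v ++ [:: b; a; c] ++ w in
        let bca := v ++ [:: b; c; a] ++ w in
        let acb := v ++ [:: a; c; b] ++ w in
        let cab := v ++ [:: c; a; b] ++ w in
        [\/ same_pair x y bac bca, same_pair x y acb cab,
            same_pair x y bac acb | same_pair x y bca cab]].

(* As edges are unordered pairs of distinct vertices, x belongs to exactly one
   i-edge iff it has exactly one i-neighbor. *)
Definition is_D0_graph (W : {set n.-tuple 'I_N})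
    (G : scgraph n {w : n.-tuple 'I_N | w \in W}) : Prop :=
  [/\ forall w, w \in W -> uniq w,
      forall i x y, edge G i x y ->
        knuth_or_rotation i (val (val x)) (val (val y)),
      forall (v w : seq 'I_N) (a b c : 'I_N), (a < b)%N -> (b < c)%N ->
        forall x : {w : n.-tuple 'I_N | w \in W},
          val (val x) \in [:: v ++ [:: b; a; c] ++ w; v ++ [:: b; c; a] ++ w;
                              v ++ [:: a; c; b] ++ w; v ++ [:: c; a; b] ++ w] ->
          exists! y, edge G (size v).+2 x y &
      forall (x : {w : n.-tuple 'I_N | w \in W}) i, (0 < i < n)%N ->
        sgn G x i = (letter (val x) i < letter (val x) i.+1)%N].

End D0.

(* Main.v *)
Require Import Defs.
From mathcomp Require Import all_boot all_order all_algebra.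
From mathcomp Require Import mpoly.

(** The graph G* below has 126 vertices and generating function
    s_431 + s_332 + s_53 - s_44.  It was found by linear programming: a set of
    words is the vertex set of a D_0 graph iff its indicator x satisfies
    x_bac + x_cab = x_bca + x_acb for all a < b < c and all contexts, and axiom 5
    becomes linear after adding a variable for each edge and for each square of
    commuting edges.  Minimizing a slightly perturbed total weight, under the
    constraints that 37812456, whose descent set is {3}, has weight 1 and every
    word of descent set {4} has weight 0, gave the integral solution used here.

    In two variables, the coefficient of x^4 y^4 minus that of x^5 y^3 is
    nonnegative for every Schur function, while for the generating function of
    a graph it is the number of vertices of descent set {4} minus the number of
    those of descent set {5}, which is -1 here.  The axioms of a D graph are
    finite checks on G*, LSP_4 and LSP_5 being reduced to equalities of
    multisets of descent sets by the expansion of a Schur function as a sum of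
    fundamental quasisymmetric functions over standard tableaux. *)

Set Implicit Arguments.
Unset Strict Implicit.
Unset Printing Implicit Defensive.
Import GRing.Theory Num.Theory.

(** * Schur functions as sums of fundamental quasisymmetric functions *)

Lemma fundamental_ext n m (S S' : pred nat) :
  (forall j, 0 < j < n -> S j = S' j) -> fundamental n S m = fundamental n S' m.
Proof.
move=> eqS; rewrite /fundamental; apply: eq_bigl => s.
apply: eq_forallb => j; apply: eq_forallb => k.
by case: eqP => //= kj; rewrite (eqS j.+1) //= -kj.
Qed.

Section Standardization.
Variables (n m : nat).
Implicit Types (t : {ffun 'I_n -> 'I_m}) (p : seq nat).

Definition fval t (k : nat) : nat := oapp (fun i => val (t i)) 0 (insub k).

Lemma fval_ord t (k : 'I_n) : fval t k = t k.
Proof. by rewrite /fval valK. Qed.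

(** Ordering positions by value, with ties broken from left to right, gives the standardization of
    [t]. *)
Definition lexle t (k l : nat) :=
  (fval t k < fval t l) || (fval t k == fval t l) && (k <= l).

Lemma lexle_total t : total (lexle t).
Proof. by move=> k l; rewrite /lexle; case: ltngtP => //= _; apply: leq_total. Qed.

Lemma lexle_trans t : transitive (lexle t).
Proof.
move=> l k q; rewrite /lexle => /orP[h1|/andP[/eqP-> h1]] /orP[h2|/andP[/eqP<- h2]].
- by rewrite (ltn_trans h1).
- by rewrite h1.
- by rewrite h2.
- by rewrite eqxx (leq_trans h1 h2) orbT.
Qed.

Lemma lexle_anti t : antisymmetric (lexle t).
Proof.
move=> k l; rewrite /lexle; case: ltngtP => //= _.
by rewrite -eqn_leq => /eqP.
Qed.

Definition desc p (j : nat) := nth 0 p j < nth 0 p j.-1.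

(** Along [p] the values of [t] increase weakly, and strictly where [p] descends, since a tie needs
    increasing positions. Composing [t] with [p] thus gives exactly the maps counted by
    [fundamental]. *)
Lemma sum_sorted_perm p : p \in permutations (iota 0 n) ->
  (\sum_(t : {ffun 'I_n -> 'I_m} | sorted (lexle t) p)
     \prod_(k < n) 'X_(t k) = fundamental n (desc p) m :> {mpoly int[m]})%R.
Proof.
rewrite mem_permutations => pp.
have szp : size p = n by rewrite (perm_size pp) size_iota.
have ltp (j : nat) : j < n -> nth 0 p j < n.
  move=> ltj; have : nth 0 p j \in p by rewrite mem_nth ?szp.
  by rewrite (perm_mem pp) mem_iota add0n.
pose pif (j : 'I_n) : 'I_n := Ordinal (ltp _ (ltn_ord j)).
have pi_inj : injective pif.
  move=> j k /(congr1 val) /= /eqP.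
  by rewrite nth_uniq ?szp ?(perm_uniq pp) ?iota_uniq // => /eqP/val_inj.
pose h t := [ffun j => t (pif j)].
have h_inj : injective h.
  move=> t u /ffunP htu; apply/ffunP => k.
  have [pinv _ pK] := injF_bij pi_inj.
  by have := htu (pinv k); rewrite !ffunE pK.
rewrite /fundamental [RHS](reindex_inj h_inj) /=.
apply: eq_big => [t|t _]; last first.
  rewrite [LHS](reindex_inj pi_inj) /=.
  by apply: eq_bigr => j _; rewrite ffunE.
have lexE (j : nat) (lj : j < n) (ljS : j.+1 < n) :
    lexle t (nth 0 p j) (nth 0 p j.+1) =
    (if desc p j.+1 then h t (Ordinal lj) < h t (Ordinal ljS)
     else h t (Ordinal lj) <= h t (Ordinal ljS)).
  rewrite /lexle /desc /= !ffunE.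
  rewrite -[nth 0 p j]/(val (pif (Ordinal lj))) -[nth 0 p j.+1]/(val (pif (Ordinal ljS))).
  rewrite !fval_ord [pif (Ordinal lj) <= _]leqNgt.
  case: (val (pif (Ordinal ljS)) < _); rewrite /= ?andbF ?orbF ?andbT //.
  by rewrite orbC -leq_eqVlt.
apply/(sortedP 0)/forallP => [srt j|srt j].
  apply/forallP => k; apply/implyP => /eqP kj.
  have lj1 : j.+1 < n by rewrite -kj ltn_ord.
  have := srt j; rewrite szp => /(_ lj1).
  rewrite (lexE _ (ltn_ord j) lj1).
  have -> : k = Ordinal lj1 by apply: val_inj.
  by have -> : Ordinal (ltn_ord j) = j by apply: val_inj.
rewrite szp => lj1; have lj := ltnW lj1.
by have /forallP/(_ (Ordinal lj1)) := srt (Ordinal lj); rewrite eqxx /= lexE.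
Qed.

Variables wk st : rel nat.

Definition monotone t :=
  [forall k : 'I_n, forall l : 'I_n,
     (wk k l ==> (t k <= t l)) && (st k l ==> (t k < t l))].

Definition linear_extension p :=
  all (fun k => all (fun l => (wk k l || st k l) ==> (index k p < index l p))
                 (iota 0 n)) (iota 0 n).

Hypothesis wk_lt : forall k l, k < n -> l < n -> wk k l -> k < l.
Hypothesis st_gt : forall k l, k < n -> l < n -> st k l -> l < k.

(** For k < l, [t k <= t l] says that k precedes l in [lexle t]; for l < k, [t k < t l] says the
    same. As weak relations increase labels and strict ones decrease them, monotonicity depends only
    on the standardization [p]. *)
Lemma monotone_sorted t p : p \in permutations (iota 0 n) ->
  sorted (lexle t) p -> monotone t = linear_extension p.
Proof.
rewrite mem_permutations => pp srt.
have inp (k : 'I_n) : val k \in p by rewrite (perm_mem pp) mem_iota add0n /=.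
have idxE (k l : 'I_n) : k != l -> (index (val k) p < index (val l) p) = lexle t k l.
  move=> nkl; apply/idP/idP => [|kl].
    exact: (sorted_ltn_index (@lexle_trans t) srt).
  rewrite ltnNge leq_eqVlt; apply/negP => /orP[/eqP e|lk].
    have := nth_index 0 (inp k); rewrite -e nth_index // => e'.
    by case/eqP: nkl; apply: val_inj.
  have lk' := sorted_ltn_index (@lexle_trans t) srt _ _ (inp l) (inp k) lk.
  by case/eqP: nkl; apply: val_inj; apply: (@lexle_anti t); rewrite kl.
have wkE (k l : 'I_n) : wk k l -> (t k <= t l) = (index (val k) p < index (val l) p).
  move=> w; have kl := wk_lt (ltn_ord k) (ltn_ord l) w.
  rewrite idxE; last by apply/eqP => e; rewrite e ltnn in kl.
  by rewrite /lexle !fval_ord (ltnW kl) andbT orbC leq_eqVlt.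
have stE (k l : 'I_n) : st k l -> (t k < t l) = (index (val k) p < index (val l) p).
  move=> w; have kl := st_gt (ltn_ord k) (ltn_ord l) w.
  rewrite idxE; last by apply/eqP => e; rewrite e ltnn in kl.
  by rewrite /lexle !fval_ord [val k <= _]leqNgt kl andbF orbF.
apply/forallP/allP => [mon k|lin k].
  rewrite mem_iota add0n => /= ltk; apply/allP => l; rewrite mem_iota add0n => /= ltl.
  have /forallP/(_ (Ordinal ltl))/andP[/implyP h1 /implyP h2] := mon (Ordinal ltk).
  apply/implyP => /orP[w|w].
    by rewrite -(wkE (Ordinal ltk) (Ordinal ltl) w); apply: h1.
  by rewrite -(stE (Ordinal ltk) (Ordinal ltl) w); apply: h2.
apply/forallP => l.
have /allP/(_ (val l)) := lin (val k) ltac:(by rewrite mem_iota add0n /=).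
rewrite mem_iota add0n /= => /(_ (ltn_ord l))/implyP h.
by apply/andP; split; apply/implyP => w; [rewrite wkE // | rewrite stE //];
   apply: h; rewrite w ?orbT.
Qed.

(* The fundamental lemma of P-partitions: the inequalities [t k <= t l] for
   [wk k l] and [t k < t l] for [st k l] define a union of the classes of maps
   with a given standardization. *)
Lemma sum_monotone :
  (\sum_(t : {ffun 'I_n -> 'I_m} | monotone t) \prod_(k < n) 'X_(t k) =
   \sum_(p <- permutations (iota 0 n) | linear_extension p)
      fundamental n (desc p) m :> {mpoly int[m]})%R.
Proof.
transitivity (\sum_(t : {ffun 'I_n -> 'I_m})
   \sum_(p <- permutations (iota 0 n) | linear_extension p && sorted (lexle t) p)
     \prod_(k < n) 'X_(t k) : {mpoly int[m]})%R; last first.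
  rewrite (exchange_big_dep linear_extension) /=; last by move=> t p _ /andP[].
  rewrite big_seq_cond [RHS]big_seq_cond; apply: eq_bigr => p /andP[pp lin].
  rewrite -sum_sorted_perm //; apply: eq_bigl => t; by rewrite lin.
rewrite big_mkcond; apply: eq_bigr => t _.
(* [t] is sorted along exactly one permutation, so the inner sum has at most one term. *)
pose q := sort (lexle t) (iota 0 n).
have qp : q \in permutations (iota 0 n) by rewrite mem_permutations perm_sort.
have srtq : sorted (lexle t) q by apply: sort_sorted; apply: lexle_total.
rewrite [RHS]big_seq_cond [RHS](eq_bigl (fun p => (p == q) && monotone t)); last first.
  move=> p /=; apply/and3P/andP => [[pp lin srt]|[/eqP-> mon]].
    rewrite (monotone_sorted pp srt); split=> //; apply/eqP.
    apply: (sorted_eq (@lexle_trans t) (@lexle_anti t)) => //.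
    by rewrite !mem_permutations in pp qp; rewrite (perm_trans pp) // perm_sym.
  by rewrite -(monotone_sorted qp srtq).
case: ifP => mon; last by rewrite big_pred0 // => p; rewrite andbF.
rewrite (eq_bigl (pred1 q)); last by move=> p; rewrite andbT.
by rewrite -big_filter filter_pred1_uniq ?permutations_uniq // big_seq1.
Qed.

End Standardization.

(** * Standard tableaux, their descent sets and Schur functions of explicit shapes *)

Section Shapes.
Variables (n : nat) (sh : seq nat).

Definition shape_ffun : {ffun 'I_n -> 'I_n.+1} :=
  [ffun r : 'I_n => inord (nth 0 sh r)].

(* The cells are listed column by column, from bottom to top: this labelling
   decreases along the strict relations (columns) and increases along the weak
   ones (rows). *)
Definition cells : seq (nat * nat) :=
  flatten [seq [seq (r, c) | r <- rev (iota 0 n) & c < nth 0 sh r] | c <- iota 0 n].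

Definition row_rel (cs : seq (nat * nat)) (k l : nat) :=
  let x := nth (0, 0) cs k in let y := nth (0, 0) cs l in
  (x.1 == y.1) && (x.2 < y.2).

Definition col_rel (cs : seq (nat * nat)) (k l : nat) :=
  let x := nth (0, 0) cs k in let y := nth (0, 0) cs l in
  (x.2 == y.2) && (x.1 < y.1).

(** Everything required of a shape, including the compatibility of the labelling with rows and
    columns, is left to evaluation on the few shapes in use. *)
Definition is_shape : bool :=
  [&& size cells == n, uniq cells,
      all (fun r => nth 0 sh r <= n) (iota 0 n),
      all (fun r => all (fun q => (r <= q) ==> (nth 0 sh q <= nth 0 sh r)) (iota 0 n))
        (iota 0 n),
      sumn (mkseq (nth 0 sh) n) == n
    & all (fun k => all (fun l =>
        (row_rel cells k l ==> (k < l)) && (col_rel cells k l ==> (l < k)))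
        (iota 0 n)) (iota 0 n)].

(** A linear extension [p] is a standard tableau: its entry at 0-based index j is the label of the
    cell containing j+1. With this labelling, [desc p j] holds iff j+1 lies in a lower row than j,
    the usual tableau descent. *)
Definition tableau_descents : seq (seq nat) :=
  let cs := cells in
  [seq [seq j <- iota 1 n.-1 | desc p j]
     | p <- permutations (iota 0 n) & linear_extension n (row_rel cs) (col_rel cs) p].

Lemma mem_cells r c : ((r, c) \in cells) = [&& r < n, c < n & c < nth 0 sh r].
Proof.
apply/flatten_mapP/and3P => [[c' c'n /mapP[r' + [-> ->]]]|[rn cn cr]].
  move: c'n; rewrite mem_filter mem_rev !mem_iota !add0n /= => -> /andP[-> ->] //.
exists c; first by rewrite mem_iota.
by apply: map_f; rewrite mem_filter cr mem_rev mem_iota.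
Qed.

Hypothesis sh_ok : is_shape.

Lemma shape_ffunE (r : 'I_n) : shape_ffun r = nth 0 sh r :> nat.
Proof.
rewrite ffunE inordK // ltnS; case/and5P: sh_ok => _ _ /allP h _ _.
by apply: h; rewrite mem_iota add0n /=.
Qed.

Lemma is_partition_shape : is_partition shape_ffun.
Proof.
case/and5P: sh_ok => _ _ _ /allP h /andP[/eqP s _]; apply/andP; split.
  apply/forallP => r; apply/forallP => q; rewrite !shape_ffunE.
  have /allP := h r ltac:(by rewrite mem_iota add0n /=); apply.
  by rewrite mem_iota add0n /=.
apply/eqP; rewrite -[RHS]s sumnE big_map -[n in iota 0 n]subn0.
rewrite -/(index_iota 0 n) big_mkord; apply: eq_bigr => r _.
by rewrite shape_ffunE.
Qed.

(** Semistandard tableaux correspond to monotone maps on labels through the bijection [g] from a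
    cell to its position in [cells]; [sum_monotone] then gives the expansion. *)
Lemma schur_shape m :
  (schur shape_ffun m =
   \sum_(D <- tableau_descents) fundamental n (fun j => j \in D) m)%R.
Proof.
case/and5P: (sh_ok) => /eqP szc unc _ _ /andP[_ /allP ord].
have {}ord k l : k < n -> l < n ->
    (row_rel cells k l ==> (k < l)) && (col_rel cells k l ==> (l < k)).
  move=> kn ln; have /allP := ord k ltac:(by rewrite mem_iota add0n).
  by apply; rewrite mem_iota add0n.
transitivity (\sum_(t : {ffun 'I_n -> 'I_m} | monotone (row_rel cells) (col_rel cells) t)
     \prod_(k < n) 'X_(t k) : {mpoly int[m]})%R; last first.
  rewrite sum_monotone; first last.
  - by move=> k l kn ln w; have := ord k l kn ln; rewrite w => /andP[].
  - by move=> k l kn ln w; have := ord k l kn ln; rewrite w => /andP[].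
  rewrite /tableau_descents big_map big_filter; apply: eq_bigr => p _.
  apply: fundamental_ext => j /andP[j0 jn]; rewrite mem_filter mem_iota j0 /=.
  by rewrite add1n prednK ?jn ?andbT //; apply: leq_ltn_trans jn.
pose pos (x : cell shape_ffun) := (val (val x).1, val (val x).2).
have posP (x : cell shape_ffun) : pos x \in cells.
  rewrite mem_cells !ltn_ord /=; move: (valP x); by rewrite shape_ffunE.
have ltg (x : cell shape_ffun) : index (pos x) cells < n.
  by rewrite -szc index_mem.
pose g x : 'I_n := Ordinal (ltg x).
have gE x : nth (0, 0) cells (g x) = pos x by rewrite nth_index.
have g_inj : injective g.
  move=> x y /(congr1 (fun k : 'I_n => nth (0, 0) cells k)); rewrite !gE.
  case=> /val_inj e1 /val_inj e2; apply: val_inj.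
  by rewrite [LHS]surjective_pairing [RHS]surjective_pairing e1 e2.
have g_bij : bijective g.
  have sur k : exists x, g x == k.
    have kc : nth (0, 0) cells k \in cells by rewrite mem_nth ?szc.
    case E : (nth (0, 0) cells k) kc => [r c]; rewrite mem_cells => /and3P[rn cn cr].
    have h : (Ordinal cn < shape_ffun (Ordinal rn))%N by rewrite shape_ffunE.
    exists (exist _ (Ordinal rn, Ordinal cn) h); apply/eqP/val_inj => /=.
    by rewrite /pos /= -E index_uniq ?szc.
  exists (fun k => xchoose (sur k)) => [x|k]; last by apply/eqP/(xchooseP (sur k)).
  by apply: g_inj; apply/eqP/(xchooseP (sur (g x))).
have [ginv gK ginvK] := g_bij.
pose h (t : {ffun 'I_n -> 'I_m}) : {ffun cell shape_ffun -> 'I_m} := [ffun x => t (g x)].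
have h_bij : bijective h.
  exists (fun T : {ffun cell shape_ffun -> 'I_m} => [ffun k => T (ginv k)]) => [t|T].
    by apply/ffunP => k; rewrite !ffunE ginvK.
  by apply/ffunP => x; rewrite !ffunE gK.
rewrite /schur (reindex h) /=; last exact: onW_bij.
apply: eq_big => [t|t _]; last first.
  rewrite [RHS](reindex g) /=; last exact: onW_bij.
  by apply: eq_bigr => x _; rewrite ffunE.
rewrite /semistandard /monotone.
have E x y :
   (row_rel cells (g x) (g y) = ((val x).1 == (val y).1) && ((val x).2 < (val y).2)%N)
   /\ (col_rel cells (g x) (g y) = ((val x).2 == (val y).2) && ((val x).1 < (val y).1)%N).
  by rewrite /row_rel /col_rel !gE.
apply/forallP/forallP => H => [k|x].
  apply/forallP => l; have /forallP/(_ (ginv l)) := H (ginv k).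
  by rewrite !ffunE -!(E _ _).1 -!(E _ _).2 !ginvK.
apply/forallP => y; have /forallP/(_ (g y)) := H (g x).
by rewrite !ffunE -!(E _ _).1 -!(E _ _).2.
Qed.

End Shapes.

(** The Schur coefficients are the multiplicities of the shapes in [shs], so that positivity reduces
    to an equality of multisets of descent sets. *)
Lemma schur_positive_sum n (f : forall m, {mpoly int[m]}) (Ds shs : seq (seq nat)) :
  all (is_shape n) shs ->
  perm_eq Ds (flatten [seq tableau_descents n sh | sh <- shs]) ->
  (forall m, f m = \sum_(D <- Ds) fundamental n (fun j => j \in D) m)%R ->
  schur_positive n f.
Proof.
move=> shs_ok eqDs fE.
exists (fun la => (count_mem la [seq shape_ffun n sh | sh <- shs])%:R%R).
split=> [la|m]; first by rewrite ler0n.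
rewrite fE (perm_big _ eqDs) /= {Ds eqDs fE}.
elim: shs shs_ok => [|sh shs IH] /=.
  by rewrite big_nil big1 // => la _; rewrite scale0r.
case/andP=> sh_ok /IH {}IH; rewrite big_cat /= IH -schur_shape //.
under [RHS]eq_bigr => la _ do rewrite natrD scalerDl.
rewrite big_split /=; congr (_ + _)%R.
rewrite (bigD1 (shape_ffun n sh)) /=; last exact: is_partition_shape.
rewrite eqxx scale1r big1 ?addr0 // => la /andP[_ /negPf].
by rewrite eq_sym => ->; rewrite scale0r.
Qed.

(** * Coefficients in two variables *)

Lemma card_lt_ord n z : z <= n -> #|[set j : 'I_n | j < z]| = z.
Proof.
by move=> zn; rewrite -sum1dep_card -(big_ord_widen n (fun=> 1) zn) sum1_card card_ord.
Qed.

(** An element j of [D] brings all of 0, ..., j into [D], so j < #|D|; comparing cardinalities does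
    the rest. *)
Lemma down_closed_eq n (D : {set 'I_n}) :
  (forall i j : 'I_n, i <= j -> j \in D -> i \in D) ->
  D = [set j : 'I_n | j < #|D|].
Proof.
move=> dc.
have cD : #|D| <= n by rewrite -[X in _ <= X](card_ord n) max_card.
apply/eqP; rewrite eqEcard card_lt_ord // leqnn andbT.
apply/subsetP => j jD; rewrite inE -(@card_lt_ord n j.+1) //.
apply: subset_leq_card; apply/subsetP => i; rewrite inE ltnS => ij.
exact: dc jD.
Qed.

Lemma mem_iota1 n j : (j \in iota 1 n.-1) = (0 < j < n).
Proof. by rewrite mem_iota; case: n => [|n]; case: j. Qed.

Section TwoVariables.

Definition mon2 (z w : nat) : 'X_{1..2} := [multinom (if i == ord0 then z else w) | i < 2].

Lemma ord2_neq0 (a : 'I_2) : (a != ord0) = (a == ord_max).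
Proof. by case: a => [[|[|]]]. Qed.

Definition content (I : finType) (T : I -> 'I_2) a : nat := #|[set x | T x == a]|.

Lemma mcoeff_prod2 (I : finType) (T : I -> 'I_2) z w :
  ((\prod_x 'X_(T x) : {mpoly int[2]})@_(mon2 z w)
     = ((content T ord0 == z) && (content T ord_max == w))%:R)%R.
Proof.
rewrite mprodXE mcoeffX; congr (nat_of_bool _)%:R%R.
have cE a : (\sum_x U_(T x))%MM a = content T a.
  rewrite mnm_sumE /content -sum1dep_card [RHS]big_mkcond /=.
  by apply: eq_bigr => x _; rewrite mnm1E; case: eqP.
apply/eqP/andP => [e|[/eqP e0 /eqP e1]].
  by rewrite -!cE e !mnmE.
apply/mnmP => a; rewrite cE mnmE; case: eqP => [->//|/eqP].
by rewrite ord2_neq0 => /eqP->.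
Qed.

Lemma content2 (I : finType) (T : I -> 'I_2) :
  content T ord0 + content T ord_max = #|I|.
Proof.
rewrite -(cardsC [set x | T x == ord0]); congr (_ + _).
by apply: eq_card => x; rewrite !inE ord2_neq0.
Qed.

(** A weakly increasing map to two values with z zeros must be the step map [s0], which can increase
    strictly only at position z; it is counted iff [S] demands no other strict increase. *)
Lemma fundamental_mon2 n S z : z <= n ->
  ((fundamental n S 2)@_(mon2 z (n - z))
     = (all (fun j => S j ==> (j == z)) (iota 1 n.-1))%:R)%R.
Proof.
move=> zn; rewrite /fundamental raddf_sum /=.
under eq_bigr => s _ do rewrite mcoeff_prod2.
pose s0 : {ffun 'I_n -> 'I_2} := [ffun j : 'I_n => if j < z then ord0 else ord_max].
have c0 : (content s0 ord0 == z) && (content s0 ord_max == n - z).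
  have := content2 s0; rewrite card_ord; move: (content s0 ord_max) => w e.
  suff c : content s0 ord0 = z by rewrite c eqxx; move: e; rewrite c => <-; rewrite addKn eqxx.
  rewrite /content.
  have -> : [set x | s0 x == ord0] = [set x : 'I_n | x < z].
    by apply/setP => x; rewrite !inE ffunE; case: ltnP.
  exact: card_lt_ord.
pose P (s : {ffun 'I_n -> 'I_2}) := [forall j : 'I_n, forall k : 'I_n,
  (k == j.+1 :> nat) ==> (if S j.+1 then s j < s k else s j <= s k)].
rewrite (eq_bigl P) //.
have uniqs s : P s -> content s ord0 = z -> s = s0.
  move=> /forallP Ps cs.
  have step (j k : 'I_n) : k = j.+1 :> nat -> s j <= s k.
    move=> kj; have /forallP/(_ k) := Ps j; rewrite kj eqxx /=.
    by case: ifP => // _ /ltnW.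
  have mono d : forall i j : 'I_n, j = i + d :> nat -> s i <= s j.
    elim: d => [|d IH] i j jE.
      by have -> : i = j by apply: val_inj; rewrite /= jE addn0.
    have lt : i + d < n by rewrite (leq_ltn_trans _ (ltn_ord j)) // jE addnS.
    apply: leq_trans (IH i (Ordinal lt) erefl) (step _ _ _).
    by rewrite jE addnS.
  have dc : [set x | s x == ord0] = [set j : 'I_n | j < z].
    rewrite -cs; apply: down_closed_eq => i j ij; rewrite !inE => /eqP sj.
    have := mono (j - i) i j; rewrite subnKC // => /(_ erefl).
    by rewrite sj leqn0.
  apply/ffunP => j; rewrite ffunE.
  have := congr1 (fun A : {set 'I_n} => j \in A) dc; rewrite !inE => <-.
  by case: eqP => // /eqP; rewrite ord2_neq0 => /eqP.
have P0 : P s0 = all (fun j => S j ==> (j == z)) (iota 1 n.-1).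
  apply/forallP/allP => [Ps j|H j].
    rewrite mem_iota1 => /andP[j0 jn']; apply/implyP => Sj.
    have jp : j.-1 < n by apply: leq_ltn_trans jn'; apply: leq_pred.
    have /forallP/(_ (Ordinal jn')) := Ps (Ordinal jp).
    rewrite /= prednK // eqxx Sj /= !ffunE /=.
    case: (ltnP j.-1 z) => h1; case: (ltnP j z) => h2 //= _; rewrite eqn_leq h2 andbT.
    by rewrite -(prednK j0).
  apply/forallP => k; apply/implyP => /eqP kj.
  have jz : S j.+1 -> j.+1 = z.
    move=> Sj; have jn : j.+1 \in iota 1 n.-1 by rewrite mem_iota1 ltn0Sn -kj ltn_ord.
    exact/eqP/(implyP (H _ jn)).
  rewrite !ffunE kj; case: ifP => [/jz <-|_]; first by rewrite ltnn ltnSn.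
  case: (ltnP j.+1 z) => h1; first by rewrite (ltnW h1).
  by case: ifP.
rewrite -P0; case Ps : (P s0); last first.
  rewrite big1 // => s Pss; case: andP => // -[/eqP cs _].
  by rewrite -(uniqs s) // Pss in Ps.
rewrite (bigD1 s0) //= c0 big1 ?addr0 // => s /andP[Pss ns].
by case: andP => // -[/eqP cs _]; rewrite (uniqs s) ?eqxx in ns.
Qed.

Lemma mcoeff_schur n (la : {ffun 'I_n -> 'I_n.+1}) z w :
  ((schur la 2)@_(mon2 z w) =
   #|[set T : {ffun cell la -> 'I_2} |
      semistandard T && ((content T ord0 == z) && (content T ord_max == w))]|%:R)%R.
Proof.
rewrite /schur raddf_sum /=; under eq_bigr => T _ do rewrite mcoeff_prod2.
by rewrite -natr_sum -big_mkcondr sum1dep_card.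
Qed.

(* In a tableau with z.+1 zeros and w <= z ones, column z consists of a single
   cell, which holds the last zero; turning it into a one gives a tableau. *)
Lemma mcoeff_schur_le n (la : {ffun 'I_n -> 'I_n.+1}) z w :
  is_partition la -> w <= z ->
  ((schur la 2)@_(mon2 z.+1 w) <= (schur la 2)@_(mon2 z w.+1))%R.
Proof.
move=> /andP[/forallP la_anti _] wz; rewrite !mcoeff_schur ler_nat.
set A := [set T : {ffun _ -> _} | _]; set B := [set T : {ffun _ -> _} | _].
pose corner (x : cell la) := ((val x).1 == 0 :> nat) && ((val x).2 == z :> nat).
pose f (T : {ffun cell la -> 'I_2}) : {ffun cell la -> 'I_2} :=
  [ffun x => if corner x then ord_max else T x].
have row_le (T : {ffun cell la -> 'I_2}) (x y : cell la) : semistandard T ->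
    (val x).1 = (val y).1 -> (val x).2 < (val y).2 -> T x <= T y.
  move=> /forallP/(_ x)/forallP/(_ y)/andP[/implyP h _] e lt.
  by apply: h; rewrite e eqxx.
have col_lt (T : {ffun cell la -> 'I_2}) (x y : cell la) : semistandard T ->
    (val x).2 = (val y).2 -> (val x).1 < (val y).1 -> T x < T y.
  move=> /forallP/(_ x)/forallP/(_ y)/andP[_ /implyP h] e lt.
  by apply: h; rewrite e eqxx.
have la_le (r q : 'I_n) : r <= q -> la q <= la r.
  by have /forallP/(_ q)/implyP := la_anti r.
have cell_up (x : cell la) (r c : 'I_n) : r <= (val x).1 -> c <= (val x).2 ->
    exists y : cell la, val y = (r, c).
  move=> rx cx; have h : ((r, c).2 < la (r, c).1)%N.
    by rewrite /= (leq_ltn_trans cx) // (leq_trans (valP x)) // la_le.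
  by exists (exist _ (r, c) h).
(* A zero below the first row would need a smaller entry above it. *)
have zero_row (T : {ffun cell la -> 'I_2}) (x : cell la) :
    semistandard T -> T x = ord0 -> (val x).1 = 0 :> nat.
  move=> ssT Tx; apply/eqP; rewrite -leqn0 leqNgt; apply/negP => r0.
  pose r := Ordinal (ltn_trans r0 (ltn_ord (val x).1)).
  have [y yE] := cell_up x r (val x).2 (leq0n _) (leqnn _).
  by have := col_lt T y x ssT; rewrite yE /= Tx => /(_ erefl r0).
(* The zeros fill the first z+1 cells of the first row: their columns form a down-closed set of size
   z+1. *)
have zeros (T : {ffun cell la -> 'I_2}) : T \in A -> (exists x, corner x) /\
    forall x : cell la, (T x == ord0) = ((val x).1 == 0 :> nat) && ((val x).2 < z.+1).
  rewrite inE => /andP[ssT /andP[/eqP c0 _]].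
  pose D : {set 'I_n} := [set (val x).2 | x in [set x | T x == ord0]].
  have cD : #|D| = z.+1.
    rewrite -c0 card_in_imset // => x y; rewrite !inE => /eqP Tx /eqP Ty e.
    apply: val_inj; rewrite [LHS]surjective_pairing [RHS]surjective_pairing e.
    by congr (_, _); apply: val_inj; rewrite /= (zero_row T x) // (zero_row T y).
  have dc : D = [set j : 'I_n | j < z.+1].
    rewrite -cD; apply: down_closed_eq => i j ij /imsetP[x]; rewrite inE => /eqP Tx jE.
    move: ij; rewrite leq_eqVlt => /orP[/eqP/val_inj->|ij].
      by apply/imsetP; exists x; rewrite // inE Tx.
    have [|y yE] := cell_up x (val x).1 i (leqnn _); first by rewrite -jE ltnW.
    apply/imsetP; exists y; last by rewrite yE.
    rewrite inE -[_ == _]/(T y == 0 :> nat) -leqn0.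
    have := row_le T y x ssT; rewrite yE /= Tx; apply=> //.
    by rewrite -jE.
  have zn : z < n by rewrite -cD -[X in _ <= X](card_ord n) max_card.
  have : Ordinal zn \in D by rewrite dc inE /=.
  case/imsetP => x; rewrite inE => /eqP Tx zx; split.
    by exists x; rewrite /corner (zero_row T x) // -zx !eqxx.
  clear x Tx zx.
  have inD (x : cell la) : ((val x).2 < z.+1) = ((val x).2 \in D) by rewrite dc inE.
  move=> x; rewrite inD; apply/eqP/andP => [Tx|[/eqP x0 /imsetP[y]]].
    by rewrite (zero_row T) //; split=> //; apply/imsetP; exists x; rewrite // inE Tx.
  rewrite inE => /eqP Ty xy; rewrite -Ty; congr (T _); apply: val_inj.
  rewrite [LHS]surjective_pairing [RHS]surjective_pairing xy.
  by congr (_, _); apply: val_inj; rewrite /= (zero_row T y).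
have corner_inj x y : corner x -> corner y -> x = y.
  move=> /andP[/eqP x0 /eqP xz] /andP[/eqP y0 /eqP yz]; apply: val_inj.
  rewrite [LHS]surjective_pairing [RHS]surjective_pairing.
  by congr (_, _); apply: val_inj; rewrite /= ?x0 ?xz.
have max_le (a : 'I_2) : a <= (ord_max : 'I_2) by rewrite -ltnS ltn_ord.
have fA T : T \in A -> f T \in B.
  move=> TA; have [[x0 cx0] zT] := zeros T TA.
  move: TA; rewrite !inE => /andP[ssT /andP[/eqP c0 /eqP c1]].
  have Tx0 : T x0 = ord0.
    by apply/eqP; rewrite zT; case/andP: cx0 => -> /eqP->; rewrite ltnSn.
  have cornerE x : corner x = (x == x0).
    by apply/idP/eqP => [/corner_inj/(_ cx0)|->].
  (* A cell under the corner would have z+1 nonzero entries in its row, in columns 0 to z, more than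
     the w <= z ones available. *)
  have below (x y : cell la) : corner x -> (val x).2 = (val y).2 ->
      (val x).1 < (val y).1 -> False.
    move=> /andP[/eqP r0 /eqP cz] exy; rewrite r0 => y1.
    have /subset_leq_card : [set j : 'I_n | j < z.+1] \subset
        [set (val x).2 | x in [set x | T x == ord_max]].
      apply/subsetP => j; rewrite inE ltnS => jz.
      have [||u uE] := cell_up y (val y).1 j; rewrite ?leqnn -?exy ?cz //.
      apply/imsetP; exists u; last by rewrite uE.
      by rewrite inE -ord2_neq0 zT uE /= gtn_eqF.
    rewrite card_lt_ord; last by rewrite -cz ltn_ord.
    move=> le1; have := leq_trans le1 (leq_imset_card _ _).
    by rewrite -[#|_|]/(content T ord_max) c1 ltnNge wz.
  apply/andP; split.
    apply/forallP => x; apply/forallP => y; rewrite !ffunE.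
    apply/andP; split; apply/implyP => /andP[/eqP e lt].
      case: ifPn => cx; case: ifPn => cy //.
        have : T y != ord0.
          rewrite zT -e; case/andP: cx => -> /eqP cz /=.
          by rewrite -leqNgt -cz.
        by rewrite ord2_neq0 => /eqP->.
      exact: row_le.
    case: ifPn => cx; first by case: (below x y cx e lt).
    case: ifPn => cy; last exact: col_lt.
    by move: lt; case/andP: cy => /eqP->.
  have Z0 : [set x | f T x == ord0] = [set x | T x == ord0] :\ x0.
    apply/setP => x; rewrite !inE ffunE cornerE.
    by case: (x == x0).
  have Z1 : [set x | f T x == ord_max] = x0 |: [set x | T x == ord_max].
    apply/setP => x; rewrite !inE ffunE cornerE.
    by case: (x == x0).
  rewrite /content Z0 Z1 cardsU1 inE Tx0 /=.
  rewrite -[#|[set x | T x == ord_max]|]/(content T ord_max) c1.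
  have := cardsD1 x0 [set x | T x == ord0]; rewrite inE Tx0 eqxx.
  rewrite -[#|[set x | T x == ord0]|]/(content T ord0) c0 => -[].
  by rewrite add0n => <-; rewrite eqxx add1n eqxx.
(* [zeros] fixes the value of [T] at the corner, the only one that [f] overwrites. *)
have f_inj : {in A &, injective f}.
  move=> T T' /zeros[_ zT] /zeros[_ zT'] /ffunP e; apply/ffunP => x.
  have := e x; rewrite !ffunE; case: ifP => // cx _.
  have h : ((val x).1 == 0 :> nat) && ((val x).2 < z.+1).
    by case/andP: cx => -> /eqP->; rewrite ltnSn.
  by apply/eqP; move: (zT x) (zT' x); rewrite h => /eqP-> /eqP->.
rewrite -(card_in_imset f_inj); apply: subset_leq_card.
by apply/subsetP => _ /imsetP[T TA ->]; apply: fA.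
Qed.

End TwoVariables.

(** * Certificates *)

Section Reach.
Variables (V : finType) (code : V -> nat) (e : rel V) (adj : nat -> seq nat).
Hypothesis adjP : forall u l, reflect (exists2 v, e u v & code v = l) (l \in adj (code u)).

Definition expand (L : seq nat) : seq nat := undup (L ++ flatten [seq adj k | k <- L]).

(* The number q of iterations is irrelevant to correctness: the results are
   checked to be closed whenever completeness matters. *)
Fixpoint reach (q : nat) (L : seq nat) : seq nat :=
  if q is q'.+1 then
    let L' := expand L in if size L' == size L then L else reach q' L'
  else L.

Definition closed_list (L : seq nat) : bool := all (fun k => all (mem L) (adj k)) L.

Lemma mem_reach q k L : k \in L -> k \in reach q L.
Proof.
elim: q L => //= q IH L kL; case: ifP => // _.
by apply: IH; rewrite mem_undup mem_cat kL.
Qed.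

Lemma reach_sound q x l : l \in reach q [:: code x] ->
  exists2 v, connect e x v & code v = l.
Proof.
have: forall k, k \in [:: code x] -> exists2 v, connect e x v & code v = k.
  by move=> k; rewrite inE => /eqP->; exists x; rewrite ?connect0.
elim: q [:: code x] => [|q IH] L sndL /=; first exact: sndL.
case: ifP => _; [exact: sndL | apply: IH => k].
rewrite mem_undup mem_cat => /orP[/sndL//|/flattenP[s /mapP[p /sndL[u xu <-]] ->]].
by case/adjP => v uv <-; exists v => //; apply: connect_trans xu (connect1 uv).
Qed.

Lemma closed_list_connect L x v : closed_list L -> code x \in L -> connect e x v ->
  code v \in L.
Proof.
move=> clL xL /connectP[p pth ->] {v}; elim: p x xL pth => [|y p IH] x xL //=.
case/andP=> xy; apply: IH; have /allP := allP clL _ xL; apply.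
by apply/adjP; exists y.
Qed.

End Reach.

(** Each step by [E G (i - 2)] or [E G i.-1] stays inside the string, and by axiom 0 [E G (i - 2)]
    sends x^{2j+1} back to y, the vertex without type W. *)
Lemma flat_chain_weak n (V : finType) (G : scgraph n V) i h x :
  axiom0 G -> flat_chain G i h x -> weak_flat_chain G i h x.
Proof.
move=> ax0 [base link]; split=> // j jh; have [k [y [kE Wy yE]]] := link j jh.
have EP u v l : E G l u = Some v -> edge G l u v.
  by rewrite /E; case: pickP => // w uw [<-].
have {yE}yx := EP _ _ _ yE; split; last first.
  exists y => //; rewrite /E; case: pickP => [w|/(_ y)]; last by rewrite edge_sym yx.
  by rewrite edge_sym in yx => xw; rewrite (ax0 _ _ _ _ yx xw).
rewrite inE; apply: (@connect_trans _ _ y); last by apply: connect1; rewrite yx.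
elim: k y kE {Wy yx} => [|k IH] y; first by case=> ->; apply: connect0.
have -> : EE G i k.+1 (x (2 * j)) =
    obind (E G i.-1) (obind (E G (i - 2)) (EE G i k (x (2 * j)))) by [].
case: (EE G i k _) IH => //= u /(_ u erefl) xu.
case Eu: (E G (i - 2) u) => [v|] //= /EP vy.
apply: connect_trans xu _; apply: (@connect_trans _ _ v).
  by apply: connect1; rewrite (EP _ _ _ Eu).
by apply: connect1; rewrite vy orbT.
Qed.

(* [bad] contains every pair of the chain that follows a pair without type W;
   as type W persists inside [bad], it is never lost after being regained. *)
Lemma chain_certificate n (V : finType) (G : scgraph n V) i h x (bad : pred V) :
  chain_base G i h x ->
  (forall u v, E G i u = Some v -> typeW G i.+1 u = typeW G i.+1 v) ->
  (forall m, 0 < m <= h -> ~~ typeW G i.+1 (x (2 * m).-1) -> bad (x (2 * m).-1)) ->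
  (forall m, 0 < m < h -> bad (x (2 * m).-1) ->
     bad (x (2 * m).+1) && (typeW G i.+1 (x (2 * m).-1) ==> typeW G i.+1 (x (2 * m).+1))) ->
  forall j, 2 < j -> j < 2 * h - 1 -> typeW G i.+1 (x j) ->
    (forall k, 0 < k <= j -> typeW G i.+1 (x k)) \/
    (forall k, j <= k <= 2 * h -> typeW G i.+1 (x k)).
Proof.
move=> [_ _ x_edge] Wpair src step j j2 jh.
(* x^{2m-1} and x^{2m} form the m-th pair; type W is constant on it, so [w] and [b] look at its odd
   member only. *)
pose w m := typeW G i.+1 (x (2 * m).-1); pose b m := bad (x (2 * m).-1).
have wE k : 0 < k <= 2 * h -> typeW G i.+1 (x k) = w (uphalf k) /\ 0 < uphalf k <= h.
  move=> /andP[k0 kh].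
  have mh : 0 < uphalf k <= h by rewrite uphalf_gt0 k0 leq_uphalf_double -mul2n.
  have dbl : 2 * uphalf k = odd k + k.
    by rewrite mul2n uphalf_half doubleD -addnn -addnA odd_double_half.
  split=> //; case: (boolP (odd k)) dbl => _ dbl; first by rewrite /w dbl.
  by rewrite /w -(Wpair _ _ (x_edge _ mh)) dbl.
have {}step m : 0 < m < h -> b m -> b m.+1 /\ (w m -> w m.+1).
  have xS : (2 * m.+1).-1 = (2 * m).+1 by rewrite mulnS.
  by move=> mh bm; have /andP[b1 /implyP w1] := step m mh bm; rewrite /b /w xS.
have jh' : 0 < j <= 2 * h.
  by rewrite (ltn_trans _ j2) // ltnW // (leq_trans jh) // leq_subr.
have [-> /andP[m0 mh] wj] := wE j jh'.
(* Either all pairs up to that of x^j have type W, or an earlier pair lacks it; from that pair on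
   everything is bad, and type W persists from x^j onwards. *)
case: (boolP (all w (iota 1 (uphalf j)))) => [/allP wall|].
  left=> k /andP[k0 kj]; have kh : 0 < k <= 2 * h.
    by rewrite k0 (leq_trans kj) //; case/andP: jh'.
  have [-> /andP[u0 _]] := wE k kh; apply: wall.
  by rewrite mem_iota u0 add1n ltnS uphalf_leq.
case/allPn => p; rewrite mem_iota add1n ltnS => /andP[p0 pj] nwp; right.
have inB d : p + d <= h -> b (p + d).
  elim: d => [|d IH]; first by rewrite addn0 => ph; apply: src; rewrite ?p0.
  by rewrite addnS => pd; case: (step (p + d)); rewrite ?pd ?addn_gt0 ?p0 // IH // ltnW.
have wd d : uphalf j + d <= h -> w (uphalf j + d).
  elim: d => [|d IH]; first by rewrite addn0.
  rewrite addnS => jd; have [||_] := step (uphalf j + d).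
  - by rewrite jd addn_gt0 m0.
  - have := inB (uphalf j + d - p); rewrite subnKC ?(leq_trans pj) ?leq_addr //.
    by apply; apply: ltnW.
  by apply; apply: IH; apply: ltnW.
move=> k /andP[jk kh]; have kh' : 0 < k <= 2 * h.
  by rewrite kh (leq_trans _ jk) //; case/andP: jh'.
have [-> /andP[_ u]] := wE k kh'.
by have := wd (uphalf k - uphalf j); rewrite subnKC ?uphalf_leq //; apply.
Qed.

(** * The graph *)

(* Each entry is a word of G*, followed by the colors of the rotation edges at
   that word; all its other edges are Knuth edges.  Below, k and l denote
   vertices as positions in this list. *)
Definition vertex_data : seq (seq nat * seq nat) := [::
  ([:: 1; 3; 2; 5; 4; 8; 7; 6], [::]);  ([:: 1; 3; 2; 5; 8; 4; 7; 6], [::]);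
  ([:: 1; 3; 2; 5; 8; 7; 4; 6], [::]);  ([:: 1; 3; 2; 8; 5; 4; 7; 6], [::]);
  ([:: 1; 3; 2; 8; 5; 7; 4; 6], [::]);  ([:: 1; 3; 5; 2; 4; 8; 7; 6], [::]);
  ([:: 1; 3; 5; 2; 8; 4; 7; 6], [::]);  ([:: 1; 3; 5; 2; 8; 7; 4; 6], [::]);
  ([:: 1; 3; 5; 8; 2; 4; 7; 6], [::]);  ([:: 1; 3; 5; 8; 2; 7; 4; 6], [::]);
  ([:: 1; 3; 5; 8; 7; 2; 4; 6], [::]);  ([:: 1; 3; 8; 2; 5; 4; 7; 6], [::]);
  ([:: 1; 3; 8; 2; 5; 7; 4; 6], [::]);  ([:: 1; 3; 8; 5; 2; 4; 7; 6], [::]);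
  ([:: 1; 3; 8; 5; 2; 7; 4; 6], [::]);  ([:: 1; 3; 8; 5; 7; 2; 4; 6], [::]);
  ([:: 1; 8; 3; 2; 5; 4; 7; 6], [:: 2]);  ([:: 1; 8; 3; 2; 5; 7; 4; 6], [:: 2]);
  ([:: 1; 8; 3; 5; 2; 4; 7; 6], [:: 2]);  ([:: 1; 8; 3; 5; 2; 7; 4; 6], [:: 2]);
  ([:: 1; 8; 3; 5; 7; 2; 4; 6], [:: 2]);  ([:: 3; 1; 2; 5; 4; 8; 7; 6], [::]);
  ([:: 3; 1; 2; 5; 8; 4; 7; 6], [::]);  ([:: 3; 1; 2; 5; 8; 7; 4; 6], [::]);
  ([:: 3; 1; 2; 8; 5; 4; 7; 6], [::]);  ([:: 3; 1; 2; 8; 5; 7; 4; 6], [::]);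
  ([:: 3; 1; 5; 2; 4; 8; 7; 6], [::]);  ([:: 3; 1; 5; 2; 8; 4; 7; 6], [::]);
  ([:: 3; 1; 5; 2; 8; 7; 4; 6], [::]);  ([:: 3; 1; 5; 6; 7; 2; 8; 4], [:: 5]);
  ([:: 3; 1; 5; 6; 7; 8; 2; 4], [::]);  ([:: 3; 1; 5; 7; 2; 6; 8; 4], [:: 4; 5; 7]);
  ([:: 3; 1; 5; 7; 2; 8; 4; 6], [:: 4; 7]);  ([:: 3; 1; 5; 7; 8; 2; 4; 6], [::]);
  ([:: 3; 1; 5; 8; 2; 4; 7; 6], [::]);  ([:: 3; 1; 5; 8; 2; 7; 4; 6], [::]);
  ([:: 3; 1; 5; 8; 7; 2; 4; 6], [::]);  ([:: 3; 1; 7; 2; 5; 6; 8; 4], [:: 4; 7]);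
  ([:: 3; 1; 7; 2; 5; 8; 4; 6], [:: 4; 6; 7]);  ([:: 3; 1; 7; 2; 8; 4; 5; 6], [:: 6]);
  ([:: 3; 1; 7; 8; 2; 4; 5; 6], [::]);  ([:: 3; 1; 8; 2; 5; 4; 7; 6], [:: 2; 3]);
  ([:: 3; 1; 8; 2; 5; 7; 4; 6], [:: 2; 3]);  ([:: 3; 1; 8; 5; 2; 4; 7; 6], [:: 2; 3]);
  ([:: 3; 1; 8; 5; 2; 7; 4; 6], [:: 2; 3]);  ([:: 3; 1; 8; 5; 7; 2; 4; 6], [:: 2; 3]);
  ([:: 3; 2; 1; 5; 4; 7; 6; 8], [::]);  ([:: 3; 2; 1; 5; 4; 7; 8; 6], [::]);
  ([:: 3; 2; 1; 5; 4; 8; 7; 6], [::]);  ([:: 3; 2; 1; 5; 7; 4; 6; 8], [::]);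
  ([:: 3; 2; 1; 5; 7; 4; 8; 6], [::]);  ([:: 3; 2; 1; 5; 7; 8; 4; 6], [::]);
  ([:: 3; 2; 1; 5; 8; 4; 7; 6], [::]);  ([:: 3; 2; 1; 5; 8; 7; 4; 6], [::]);
  ([:: 3; 2; 1; 8; 5; 4; 7; 6], [:: 3; 4]);  ([:: 3; 2; 1; 8; 5; 7; 4; 6], [:: 3; 4]);
  ([:: 3; 2; 5; 1; 4; 7; 6; 8], [::]);  ([:: 3; 2; 5; 1; 4; 7; 8; 6], [::]);
  ([:: 3; 2; 5; 1; 4; 8; 7; 6], [::]);  ([:: 3; 2; 5; 1; 7; 4; 6; 8], [::]);
  ([:: 3; 2; 5; 1; 7; 4; 8; 6], [::]);  ([:: 3; 2; 5; 1; 7; 8; 4; 6], [::]);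
  ([:: 3; 2; 5; 1; 8; 4; 7; 6], [:: 4; 5]);  ([:: 3; 2; 5; 1; 8; 7; 4; 6], [:: 4; 5]);
  ([:: 3; 2; 5; 4; 1; 7; 6; 8], [::]);  ([:: 3; 2; 5; 4; 1; 7; 8; 6], [::]);
  ([:: 3; 2; 5; 4; 1; 8; 7; 6], [:: 5; 6]);  ([:: 3; 2; 5; 4; 7; 1; 6; 8], [::]);
  ([:: 3; 2; 5; 4; 7; 1; 8; 6], [:: 6; 7]);  ([:: 3; 2; 5; 4; 7; 6; 1; 8], [:: 7]);
  ([:: 3; 2; 5; 7; 1; 4; 6; 8], [::]);  ([:: 3; 2; 5; 7; 1; 4; 8; 6], [::]);
  ([:: 3; 2; 5; 7; 1; 8; 4; 6], [:: 5; 6]);  ([:: 3; 2; 5; 7; 4; 1; 6; 8], [::]);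
  ([:: 3; 2; 5; 7; 4; 1; 8; 6], [:: 6; 7]);  ([:: 3; 2; 5; 7; 4; 6; 1; 8], [:: 7]);
  ([:: 3; 5; 1; 2; 4; 8; 7; 6], [::]);  ([:: 3; 5; 1; 2; 8; 4; 7; 6], [::]);
  ([:: 3; 5; 1; 2; 8; 7; 4; 6], [::]);  ([:: 3; 5; 1; 6; 7; 2; 8; 4], [:: 5]);
  ([:: 3; 5; 1; 6; 7; 8; 2; 4], [::]);  ([:: 3; 5; 1; 7; 2; 6; 8; 4], [:: 5; 7]);
  ([:: 3; 5; 1; 7; 2; 8; 4; 6], [:: 7]);  ([:: 3; 5; 1; 7; 8; 2; 4; 6], [::]);
  ([:: 3; 5; 1; 8; 2; 4; 7; 6], [:: 3; 4]);  ([:: 3; 5; 1; 8; 2; 7; 4; 6], [:: 3; 4]);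
  ([:: 3; 5; 1; 8; 7; 2; 4; 6], [:: 3; 4]);  ([:: 3; 5; 2; 1; 4; 7; 6; 8], [::]);
  ([:: 3; 5; 2; 1; 4; 7; 8; 6], [::]);  ([:: 3; 5; 2; 1; 4; 8; 7; 6], [::]);
  ([:: 3; 5; 2; 1; 7; 4; 6; 8], [::]);  ([:: 3; 5; 2; 1; 7; 4; 8; 6], [::]);
  ([:: 3; 5; 2; 1; 7; 8; 4; 6], [::]);  ([:: 3; 5; 2; 1; 8; 4; 7; 6], [:: 4; 5]);
  ([:: 3; 5; 2; 1; 8; 7; 4; 6], [:: 4; 5]);  ([:: 3; 5; 2; 4; 1; 7; 6; 8], [::]);
  ([:: 3; 5; 2; 4; 1; 7; 8; 6], [::]);  ([:: 3; 5; 2; 4; 1; 8; 7; 6], [:: 5; 6]);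
  ([:: 3; 5; 2; 4; 7; 1; 6; 8], [::]);  ([:: 3; 5; 2; 4; 7; 1; 8; 6], [:: 6; 7]);
  ([:: 3; 5; 2; 4; 7; 6; 1; 8], [:: 7]);  ([:: 3; 5; 2; 7; 1; 4; 6; 8], [::]);
  ([:: 3; 5; 2; 7; 1; 4; 8; 6], [::]);  ([:: 3; 5; 2; 7; 1; 8; 4; 6], [:: 5; 6]);
  ([:: 3; 5; 2; 7; 4; 1; 6; 8], [::]);  ([:: 3; 5; 2; 7; 4; 1; 8; 6], [:: 6; 7]);
  ([:: 3; 5; 2; 7; 4; 6; 1; 8], [:: 7]);  ([:: 3; 5; 6; 1; 7; 2; 8; 4], [::]);
  ([:: 3; 5; 6; 1; 7; 8; 2; 4], [::]);  ([:: 3; 5; 6; 7; 1; 2; 8; 4], [::]);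
  ([:: 3; 5; 6; 7; 1; 8; 2; 4], [::]);  ([:: 3; 5; 6; 7; 8; 1; 2; 4], [::]);
  ([:: 3; 5; 7; 1; 2; 6; 8; 4], [:: 7]);  ([:: 3; 5; 7; 1; 2; 8; 4; 6], [:: 7]);
  ([:: 3; 5; 7; 1; 8; 2; 4; 6], [:: 4; 5]);  ([:: 3; 5; 7; 2; 1; 4; 6; 8], [::]);
  ([:: 3; 5; 7; 2; 1; 4; 8; 6], [::]);  ([:: 3; 5; 7; 2; 1; 8; 4; 6], [:: 5; 6]);
  ([:: 3; 5; 7; 2; 4; 1; 6; 8], [::]);  ([:: 3; 5; 7; 2; 4; 1; 8; 6], [:: 6; 7]);
  ([:: 3; 5; 7; 2; 4; 6; 1; 8], [:: 7]);  ([:: 3; 7; 1; 2; 5; 6; 8; 4], [:: 7]);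
  ([:: 3; 7; 1; 2; 5; 8; 4; 6], [:: 6; 7]);  ([:: 3; 7; 1; 2; 8; 4; 5; 6], [:: 6]);
  ([:: 3; 7; 1; 8; 2; 4; 5; 6], [::]);  ([:: 3; 7; 8; 1; 2; 4; 5; 6], [::])
].

(** Letters of the data start at 1 and ordinals at 0; reduction mod 8 supplies the bound and fixes
    0, ..., 7. *)
Definition ord8 (a : nat) : 'I_8 := Ordinal (ltn_pmod a.-1 (isT : 0 < 8)).

Definition words : seq (seq 'I_8) := [seq [seq ord8 a | a <- d.1] | d <- vertex_data].

(* A word whose letters u, y, z at positions i-1, i, i+1 are not monotone has
   its median letter first or last; the Knuth move exchanges the two other
   letters, the rotation move shifts the three letters cyclically. *)
Definition move (w : seq nat) (rot : bool) (i : nat) : seq nat :=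
  let u := nth 0 w (i - 2) in let y := nth 0 w i.-1 in let z := nth 0 w i in
  let t :=
    if (y < u < z) || (z < u < y) then if rot then [:: y; z; u] else [:: u; z; y]
    else if (u < z < y) || (y < z < u) then if rot then [:: z; u; y] else [:: y; u; z]
    else [::] in
  take (i - 2) w ++ t ++ drop i.+1 w.

(** Row k holds the neighbors of vertex k for the colors 2 to 7, evaluated once. On a monotone
    triple [move] drops three letters, and the resulting word, too short to be in the list, yields
    [None]. *)
Definition adjacency : seq (seq (option nat)) := Eval vm_compute in
  let ws := [seq d.1 | d <- vertex_data] in
  [seq [seq let k := index (move d.1 (i \in d.2) i) ws in
            if k < size ws then Some k else None | i <- iota 2 6] | d <- vertex_data].

Definition nbr (i k : nat) : option nat :=
  if 1 < i < 8 then nth None (nth [::] adjacency k) (i - 2) else None.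

Definition sgk (k s : nat) : bool :=
  let w := [seq val a | a <- nth [::] words k] in nth 0 w s.-1 < nth 0 w s.

Definition typeWk i k : bool :=
  [&& isSome (nbr i k), isSome (nbr i.-1 k) &
      if nbr i.-1 k is Some u then sgk k i == ~~ sgk u i else false].

Definition window_adj (s d k : nat) : seq nat :=
  pmap (fun t => nbr (t + s).-1 k) (iota 2 (d - 2)).

Definition window_component (s d k : nat) : seq nat :=
  reach (window_adj s d) 16 [:: k].

Lemma window_componentE s d k :
  window_component s d k = reach (window_adj s d) 16 [:: k].
Proof. by []. Qed.

Definition window_descents (s d k : nat) : seq nat :=
  [seq j <- iota 1 d.-1 | ~~ sgk k (j + s).-1].

Definition component_descents (s d k : nat) : seq (seq nat) :=
  [seq window_descents s d l | l <- window_component s d k].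

(** Necessary condition for z to be an odd member x^{2m-1} of a weak flat i-chain. *)
Definition chain_candidate i z : bool :=
  [&& isSome (nbr i z), isSome (nbr (i - 2) z) &
      if nbr i z is Some y then isSome (nbr (i - 2) y) else false].

Definition string_adj i k : seq nat := pmap (fun t => nbr t k) [:: i - 2; i.-1].

Definition string_list i k : seq nat := reach (string_adj i) 8 [:: k].

(** Contains every possible x^{2m+1} following x^{2m-1} = k. Of the distinctness in a chain only the
    part against the preceding pair is retained, which keeps the search local. *)
Definition chain_succ i k : seq nat :=
  if nbr i k is Some y then
    [seq z <- string_list i y |
       [&& z != k, z != y, chain_candidate i z &
           if nbr (i - 2) z is Some u then ~~ typeWk i.-1 u else false]]
  else [::].

(** Provides the predicate [bad] of [chain_certificate]. *)
Definition reach_from_nonW i : seq nat :=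
  reach (chain_succ i) 8
    [seq k <- iota 0 126 | chain_candidate i k && ~~ typeWk i.+1 k].

(** * Finite checks by evaluation *)

Definition all_vertices (P : pred nat) : bool := all P (iota 0 126).

Definition valid_data : bool :=
  [&& size words == 126, all (fun w => (size w == 8) && uniq w) words, uniq words &
    all_vertices (fun k => all (fun i =>
      if nbr i k is Some l then [&& l < 126, nbr i l == Some k & l != k] else true) (iota 2 6))].

Lemma data_check : valid_data. Proof. by vm_compute. Qed.

(** Each inner list is a Schur expansion, one partition per term; every window component is checked
    to match one of them. *)
Definition shapes4 := [:: [:: [:: 4]]; [:: [:: 3; 1]]; [:: [:: 2; 2]]; [:: [:: 2; 1; 1]];
   [:: [:: 2; 2]; [:: 3; 1]]].

Definition shapes5 :=
  [:: [:: [:: 5]]; [:: [:: 4; 1]]; [:: [:: 3; 2]]; [:: [:: 3; 1; 1]]; [:: [:: 2; 2; 1]];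
      [:: [:: 3; 2]; [:: 4; 1]]; [:: [:: 2; 2; 1]; [:: 3; 1; 1]; [:: 3; 2]]].

Definition check_component s d k : bool :=
  closed_list (window_adj s d) (window_component s d k) && uniq (window_component s d k).

Definition check_LSP d (shapes : seq (seq (seq nat))) : bool :=
  all (all (is_shape d)) shapes &&
  let T := [seq flatten [seq tableau_descents d sh | sh <- shs] | shs <- shapes] in
  all_vertices (fun k => all (fun s =>
    let L := window_component s d k in
    [&& closed_list (window_adj s d) L, uniq L &
        has (perm_eq [seq window_descents s d l | l <- L]) T]) (iota 1 (9 - d))).

Lemma LSP4_check : check_LSP 4 shapes4. Proof. by vm_compute. Qed.

Lemma LSP5_check : check_LSP 5 shapes5. Proof. by vm_compute. Qed.

(** Equal multisets of descent sets give equal generating functions. The colors 4 to 7 are those for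
    which both windows fit in [1,8]. *)
Definition check_axiom4'a : bool := all_vertices (fun k => all (fun i =>
  if nbr i.-1 k is Some l then
    [|| nbr i k == Some l, sgk k (i - 3) == sgk l (i - 3), sgk k i == sgk l i |
        perm_eq (component_descents (i - 3) 4 k) (component_descents (i - 2) 4 k)]
  else true) (iota 4 4)).

Lemma axiom4'a_check : check_axiom4'a. Proof. by vm_compute. Qed.

(** Hypotheses of [chain_certificate]: [B] contains the sources, type W agrees along i-edges, and
    passing to a successor stays in [B] without losing type W. Closed strings guarantee that no
    successor is missed. *)
Definition check_axiom4''b i : bool :=
  let B := reach_from_nonW i in
  [&& all (fun k => (chain_candidate i k && ~~ typeWk i.+1 k) ==> (k \in B)) (iota 0 126),
   all_vertices (fun k => closed_list (string_adj i) (string_list i k)),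
   all_vertices (fun k => if nbr i k is Some y then typeWk i.+1 k == typeWk i.+1 y else true) &
   all (fun k => all (fun z => (z \in B) && (typeWk i.+1 k ==> typeWk i.+1 z)) (chain_succ i k)) B].

Lemma axiom4''b_check : all check_axiom4''b (iota 4 4). Proof. by vm_compute. Qed.

Definition check_axiom5 : bool := all_vertices (fun k => all (fun i => all (fun j =>
   ((i + 3 <= j) || (j + 3 <= i)) ==>
   (if nbr i k is Some l then
      if nbr j l is Some p then
        if nbr j k is Some q then nbr i q == Some p else false
      else true
    else true)) (iota 2 6)) (iota 2 6)).

Lemma axiom5_check : check_axiom5. Proof. by vm_compute. Qed.

Definition check_signs : bool := all_vertices (fun k => all (fun i =>
  (isSome (nbr i k) == (sgk k i.-1 == ~~ sgk k i)) &&
  (if nbr i k is Some l then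
    [&& sgk k i.-1 == ~~ sgk l i.-1, sgk k i == ~~ sgk l i,
      all (fun h => ((h < i - 2) || (i.+1 < h)) ==> (sgk k h == sgk l h)) (iota 1 7),
      ((0 < i - 2) && (sgk k (i - 2) == ~~ sgk l (i - 2))) ==> (sgk k (i - 2) == ~~ sgk k i.-1)
    & ((i.+1 < 8) && (sgk k i.+1 == ~~ sgk l i.+1)) ==> (sgk k i.+1 == ~~ sgk k i)]
   else true)) (iota 2 6)).

Lemma signs_check : check_signs. Proof. by vm_compute. Qed.

Definition descents_within z k : bool :=
  all (fun j => (j \in window_descents 1 8 k) ==> (j == z)) (iota 1 7).

(** By [fundamental_mon2] the two counts are the coefficients of x^5 y^3 and x^4 y^4. The first
    counts only 35678124 and the second is zero. *)
Lemma descents_within_count :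
  count (descents_within 5) (iota 0 126) = (count (descents_within 4) (iota 0 126)).+1.
Proof. by vm_compute. Qed.

Definition same_pairb (x y p q : seq 'I_8) : bool :=
  (x == p) && (y == q) || (x == q) && (y == p).

(** The four candidates for (a, b, c) come from reading the letters p, q, r of [x] as bac, bca, acb
    and cab. *)
Definition knuth_or_rotationb (i : nat) (x y : seq 'I_8) : bool :=
  let v := take (i - 2) x in let w := drop i.+1 x in
  if take 3 (drop (i - 2) x) is [:: p; q; r] then
    has (fun abc : 'I_8 * 'I_8 * 'I_8 => let: (a, b, c) := abc in
      let bac := v ++ [:: b; a; c] ++ w in
      let bca := v ++ [:: b; c; a] ++ w in
      let acb := v ++ [:: a; c; b] ++ w in
      let cab := v ++ [:: c; a; b] ++ w in
      [&& a < b, b < c &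
          [|| same_pairb x y bac bca, same_pairb x y acb cab,
              same_pairb x y bac acb | same_pairb x y bca cab]])
      [:: (q, p, r); (r, p, q); (p, r, q); (q, r, p)]
  else false.

Lemma knuth_or_rotationP i x y : 1 < i < 8 -> size x = 8 ->
  knuth_or_rotationb i x y -> knuth_or_rotation i x y.
Proof.
have sameP p q s t : same_pairb p q s t -> same_pair p q s t.
  by case/orP=> /andP[/eqP-> /eqP->]; [left | right].
move=> /andP[i1 i8] szx; rewrite /knuth_or_rotationb.
case: (take 3 _) => [|p [|q [|r []]]] // /hasP[[[a b] c] _ /and3P[ab bc H]].
exists (take (i - 2) x), (drop i.+1 x), a, b, c; split=> //.
  rewrite size_take szx ifT; first by rewrite -[RHS](subnK i1) addn2.
  exact: leq_ltn_trans (leq_subr _ _) i8.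
case/or4P: H => /sameP H; [exact: Or41 | exact: Or42 | exact: Or43 | exact: Or44].
Qed.

Definition check_edges : bool := all_vertices (fun k => all (fun i =>
    if nbr i k is Some l then
      knuth_or_rotationb i (nth [::] words k) (nth [::] words l)
    else true) (iota 2 6)).

Lemma edges_check : check_edges. Proof. by vm_compute. Qed.

(** Existence in condition (ii) of D_0 graphs; uniqueness is automatic, [nbr] being a function. *)
Definition check_triples : bool := all_vertices (fun k => all (fun i =>
    let w := [seq val a | a <- nth [::] words k] in
    [|| isSome (nbr i k), nth 0 w (i - 2) < nth 0 w i.-1 < nth 0 w i
      | nth 0 w i < nth 0 w i.-1 < nth 0 w (i - 2)]) (iota 2 6)).

Lemma triples_check : check_triples. Proof. by vm_compute. Qed.

(* Otherwise a failing unification unfolds [words] and does not end. *)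
Local Opaque words adjacency.

(** * The graph on words, and the dictionary between words and positions *)

Definition Wstar : {set 8.-tuple 'I_8} := [set t : 8.-tuple 'I_8 | tval t \in words].

Local Notation V := {w : 8.-tuple 'I_8 | w \in Wstar}.

Definition code (x : V) : nat := index (tval (val x)) words.

Lemma mem_words (x : V) : tval (val x) \in words.
Proof. by have := valP x; rewrite inE. Qed.

Lemma size_words : size words = 126.
Proof. by case/and4P: data_check => /eqP. Qed.

Lemma code_lt x : code x < 126.
Proof. by rewrite -size_words index_mem mem_words. Qed.

Lemma word_code x : nth [::] words (code x) = tval (val x).
Proof. exact/nth_index/mem_words. Qed.

Lemma code_inj : injective code.
Proof.
by move=> x y e; apply/val_inj/val_inj; rewrite /= -!word_code e.
Qed.

Lemma code_surj k : k < 126 -> exists x, code x = k.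
Proof.
move=> k126; have kw : nth [::] words k \in words by rewrite mem_nth ?size_words.
have sz : size (nth [::] words k) == 8.
  by case/and4P: data_check => _ /allP/(_ _ kw)/andP[].
have tW : Tuple sz \in Wstar by rewrite inE.
exists (exist _ (Tuple sz) tW); by apply: index_uniq; rewrite ?size_words.
Qed.

Lemma all_code P : all_vertices P -> forall x, P (code x).
Proof. by move=> /allP H x; apply: H; rewrite mem_iota /= code_lt. Qed.

Lemma nbr_color i k l : nbr i k = Some l -> 1 < i < 8.
Proof. by rewrite /nbr; case: ifP. Qed.

Lemma color_iota i : (i \in iota 2 6) = (1 < i < 8).
Proof. by rewrite mem_iota. Qed.

Lemma nbr_code i (x : V) l : nbr i (code x) = Some l ->
  exists2 y, code y = l & nbr i l = Some (code x) /\ l != code x.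
Proof.
move=> xl; have := xl; move/nbr_color; rewrite -color_iota => ic.
case/and4P: data_check => _ _ _ /all_code/(_ x)/allP/(_ i ic); rewrite xl.
by case/and3P=> /code_surj[y yl] /eqP lx ne; exists y.
Qed.

Definition gedge (i : nat) : rel V := fun x y => nbr i (code x) == Some (code y).

Fact gedge_sym i x y : gedge i x y = gedge i y x.
Proof.
have imp u v : gedge i u v -> gedge i v u.
  by move=> /eqP/nbr_code[w _ [wu _]]; apply/eqP.
by apply/idP/idP; apply: imp.
Qed.

Fact gedge_irr i : irreflexive (gedge i).
Proof. by move=> x; apply/eqP => /nbr_code[_ _ [_]]; rewrite eqxx. Qed.

Fact gedge_col i x y : gedge i x y -> 1 < i < 8.
Proof. by move=> /eqP/nbr_color. Qed.

Definition Gstar : scgraph 8 V :=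
  SCGraph (fun x s => letter (val x) s < letter (val x) s.+1)
    gedge_sym gedge_irr gedge_col.

Lemma edgeE i x y : edge Gstar i x y = (nbr i (code x) == Some (code y)).
Proof. by []. Qed.

Lemma sgnE x s : sgn Gstar x s = sgk (code x) s.
Proof. by rewrite /sgk word_code. Qed.

Lemma axiom0_Gstar : axiom0 Gstar.
Proof. by move=> i v w x /eqP vw /eqP; rewrite vw => -[/code_inj]. Qed.

Lemma E_Some i x y : E Gstar i x = Some y <-> nbr i (code x) = Some (code y).
Proof.
rewrite /E; case: pickP => [w /eqP ->|none]; split=> //.
- by case=> ->.
- by case=> /code_inj ->.
- by move=> /eqP xy; have := none y; rewrite edgeE xy.
Qed.

Lemma E_code i x : nbr i (code x) = omap code (E Gstar i x).
Proof.
case Ex : (E _ _ _) => [y|] /=; first exact/E_Some.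
case xl : nbr => [l|] //; have [y yl _] := nbr_code xl.
by move: xl; rewrite -yl => /E_Some; rewrite Ex.
Qed.

Lemma admitsE i x : admits Gstar i x = isSome (nbr i (code x)).
Proof.
apply/existsP/idP => [[y /eqP->]//|]; case xl : nbr => [l|] // _.
by have [y yl _] := nbr_code xl; exists y; rewrite edgeE xl yl.
Qed.

Lemma typeWE i x : typeW Gstar i x = typeWk i (code x).
Proof.
rewrite /typeW /typeWk !admitsE [in X in _ = X]E_code.
by congr [&& _, _ & _]; rewrite E_code; case: (E _ _ _) => // u; rewrite !sgnE.
Qed.

Local Opaque nbr code sgk typeWk.

(** * The D_0 property and axioms 1, 2, 3 and 5 *)

Lemma D0_Gstar : is_D0_graph Gstar.
Proof.
split.
- move=> w; rewrite inE => ww.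
  by case/and4P: data_check => _ /allP/(_ _ ww)/andP[].
- move=> i x y xy; have ic := edge_col xy.
  move: xy; rewrite edgeE => /eqP xy.
  apply: knuth_or_rotationP; rewrite ?size_tuple //.
  have /allP/(_ i) := all_code edges_check x; rewrite color_iota => /(_ ic).
  by rewrite xy !word_code.
- move=> v w a b c ab bc x xin.
  suff : isSome (nbr (size v).+2 (code x)).
    case xl : nbr => [l|] // _; have [y yl _] := nbr_code xl.
    exists y; split=> [|z]; first by rewrite edgeE xl yl.
    by rewrite edgeE xl -yl => /eqP[/code_inj].
  have [t xE tE] : exists2 t : seq 'I_8, tval (val x) = v ++ t ++ w &
      t \in [:: [:: b; a; c]; [:: b; c; a]; [:: a; c; b]; [:: c; a; b]].
    move: xin; rewrite !inE => /or4P[] /eqP->; [exists [:: b; a; c] | exists [:: b; c; a] |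
      exists [:: a; c; b] | exists [:: c; a; b]] => //; by rewrite !inE eqxx ?orbT.
  have szt : size t = 3 by move: tE; rewrite !inE => /or4P[] /eqP->.
  have szv : size v + 3 <= 8.
    have := size_tuple (val x); rewrite xE !size_cat szt addnA => e.
    by rewrite -[X in _ <= X]e leq_addr.
  have nthE j : nth 0 [seq val a | a <- v ++ t ++ w] (size v + j) =
      nth 0 ([seq val a | a <- t] ++ [seq val a | a <- w]) j.
    by rewrite map_cat nth_cat size_map ltnNge leq_addr addKn map_cat.
  have ic : (size v).+2 \in iota 2 6.
    by rewrite color_iota /= -addn2 -ltnS -addnS.
  have /allP/(_ _ ic)/or3P := all_code triples_check x.
  rewrite word_code xE.
  (* The color |v|+2 puts the three letters at the 0-based positions |v|, |v|+1, |v|+2. *)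
  have -> : (size v).+2 - 2 = size v + 0 by rewrite subSS subn1 addn0.
  have -> : (size v).+2.-1 = size v + 1 by rewrite addn1.
  have -> : (size v).+2 = size v + 2 by rewrite addn2.
  rewrite !nthE; have ac := ltn_trans ab bc.
  (* In each of the four patterns the middle letter is the least or the greatest, so neither
     monotone order is possible. *)
  case=> // /andP[h1 h2]; move: tE h1 h2; rewrite !inE; case/or4P=> /eqP-> /= h1 h2;
    by first [move: (ltn_trans h1 ab); rewrite ltnn; done
             | move: (ltn_trans h1 ac); rewrite ltnn; done
             | move: (ltn_trans h2 bc); rewrite ltnn; done
             | move: (ltn_trans h2 ac); rewrite ltnn; done].
- by [].
Qed.

Lemma signs_edge i (x y : V) : edge Gstar i x y ->
  let k := code x in let l := code y in
  [&& sgk k i.-1 == ~~ sgk l i.-1, sgk k i == ~~ sgk l i,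
      all (fun h => ((h < i - 2) || (i.+1 < h)) ==> (sgk k h == sgk l h)) (iota 1 7),
      ((0 < i - 2) && (sgk k (i - 2) == ~~ sgk l (i - 2))) ==> (sgk k (i - 2) == ~~ sgk k i.-1)
    & ((i.+1 < 8) && (sgk k i.+1 == ~~ sgk l i.+1)) ==> (sgk k i.+1 == ~~ sgk k i)].
Proof.
move=> xy; have ic := edge_col xy; move: xy; rewrite edgeE => /eqP xy.
have /allP/(_ i) := all_code signs_check x; rewrite color_iota => /(_ ic)/andP[_].
by rewrite xy.
Qed.

Lemma axiom1_Gstar : axiom1 Gstar.
Proof.
split=> [|i x ic]; first exact: axiom0_Gstar.
rewrite admitsE !sgnE.
have /allP/(_ i) := all_code signs_check x; rewrite color_iota => /(_ ic)/andP[/eqP-> _].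
by [].
Qed.

Lemma axiom2_Gstar : axiom2 Gstar.
Proof.
move=> i x y xy; have /andP[_ i8] := edge_col xy.
have /and5P[/eqP h1 /eqP h2 /allP h3 _ _] := signs_edge xy.
have far h : 0 < h < 8 -> (h < i - 2) || (i.+1 < h) -> sgn Gstar x h = sgn Gstar y h.
  move=> hh hi; have hin : h \in iota 1 7 by rewrite mem_iota.
  by rewrite !sgnE (eqP (implyP (h3 h hin) hi)).
rewrite !sgnE; split=> // h h0 hi.
  by apply: far; rewrite ?hi // h0 (ltn_trans hi) // (leq_ltn_trans (leq_subr _ _)).
by apply: far; rewrite ?h0 ?hi ?orbT // andbT (leq_ltn_trans _ h0).
Qed.

Lemma axiom3_Gstar : axiom3 Gstar.
Proof.
move=> i x y /signs_edge/and5P[_ _ _ /implyP h1 /implyP h2]; rewrite !sgnE.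
by split=> a b; [apply: (eqP (h1 _)) | apply: (eqP (h2 _))]; rewrite a b eqxx.
Qed.

Lemma axiom5_Gstar : axiom5 Gstar.
Proof.
move=> i j w x y wx xy ij; have ic := edge_col wx; have jc := edge_col xy.
move: wx xy; rewrite !edgeE => /eqP wx /eqP xy.
have /allP/(_ i) := all_code axiom5_check w; rewrite color_iota => /(_ ic)/allP/(_ j).
rewrite color_iota => /(_ jc); rewrite ij wx xy.
case wq : (nbr j (code w)) => [q|] // /eqP qy.
by have [v vq _] := nbr_code wq; exists v; rewrite !edgeE wq vq qy !eqxx.
Qed.

(** * Window components, LSP_4, LSP_5 and axiom 4'a *)

Lemma mem_iota2 d t : (t \in iota 2 (d - 2)) = (1 < t < d).
Proof.
rewrite mem_iota; case: d => [|[|d]]; last by rewrite subn2 /= add2n.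
all: by case: t => [|[|[|t]]].
Qed.

Definition window_rel s d : rel V :=
  fun x y => [exists i : 'I_d, edge (Res Gstar s d) i x y].

Lemma window_adjP s d (x : V) l :
  reflect (exists2 v, window_rel s d x v & code v = l)
    (l \in window_adj s d (code x)).
Proof.
have RE t v : edge (Res Gstar s d) t x v =
  (1 < t < d) && (nbr (t + s).-1 (code x) == Some (code v)) by [].
rewrite /window_adj -(mem_map (@Some_inj _)) pmapS_filter; apply: (iffP mapP).
  case=> t; rewrite mem_filter mem_iota2 => /andP[_ /andP[t1 td]] tl.
  have [y yl _] := nbr_code (esym tl); exists y => //.
  by apply/existsP; exists (Ordinal td); rewrite RE /= t1 td yl tl eqxx.
case=> v /existsP[i]; rewrite RE => /andP[id /eqP xv] <-; exists (val i) => //.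
by rewrite mem_filter mem_iota2 id andbT /= xv.
Qed.

(** Closedness of the computed list shows that it exhausts the component; soundness of [reach] gives
    the converse. *)
Lemma window_componentP s d (x v : V) : check_component s d (code x) ->
  (v \in component (Res Gstar s d) x) = (code v \in window_component s d (code x)).
Proof.
rewrite /check_component => /andP[cl _].
rewrite /component in_set -[connect _ _ _]/(connect (window_rel s d) x v).
apply/idP/idP => [|vx].
  have xL : code x \in window_component s d (code x).
    by rewrite window_componentE mem_reach // mem_head.
  exact: (closed_list_connect (window_adjP s d) cl xL).
by move: vx; rewrite window_componentE => /(reach_sound (window_adjP s d))[u xu /code_inj <-].
Qed.

Lemma genfun_component s d (x : V) m : check_component s d (code x) ->
  (genfun (Res Gstar s d) (component (Res Gstar s d) x) m =
   \sum_(D <- component_descents s d (code x)) fundamental d (fun j => j \in D) m)%R.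
Proof.
move=> chk; rewrite /genfun /component_descents big_map.
have pe : perm_eq [seq code v | v in component (Res Gstar s d) x]
    (window_component s d (code x)).
  apply: uniq_perm; first by rewrite map_inj_uniq ?enum_uniq //; apply: code_inj.
    by move: chk; rewrite /check_component => /andP[].
  move=> l; apply/mapP/idP => [[v + ->]|lx].
    by rewrite mem_enum window_componentP.
  move: lx; rewrite window_componentE => /(reach_sound (window_adjP s d))[v xv vl].
  by exists v => //; rewrite mem_enum in_set.
rewrite -(perm_big _ pe) big_map big_enum /=; apply: eq_bigr => v _.
apply: fundamental_ext => j jd; rewrite mem_filter mem_iota1 jd andbT.
have -> : des (Res Gstar s d) v j = ~~ sgn Gstar v (j + s).-1 by [].
by rewrite sgnE.
Qed.

Lemma LSP_Gstar d shapes : check_LSP d shapes -> d < 9 -> LSP d Gstar.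
Proof.
move=> /andP[/allP shok /all_code chk] d9 s s0 sd x.
have /allP/(_ s) := chk x.
have -> : s \in iota 1 (9 - d).
  rewrite mem_iota; apply/andP; split; first exact: s0.
  by rewrite add1n ltnS leq_subRL ?(ltnW d9) // addnC.
move=> /(_ isT)/and3P[cl un /hasP[Ds /mapP[shs shsin ->] pe]].
have cc : check_component s d (code x) by rewrite /check_component cl.
by apply: (schur_positive_sum (shok _ shsin) pe) => m; apply: genfun_component.
Qed.

Lemma axiom4'a_Gstar : axiom4'a Gstar.
Proof.
move=> i w v i3 i8 /eqP wv /eqP nwv s3 si m.
have i4 : 3 < i by rewrite -subn_gt0.
have ic : i \in iota 4 4 by rewrite mem_iota; apply/andP; split; [exact: i4 | exact: i8].
have /allP/(_ i ic) := all_code axiom4'a_check w; rewrite wv.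
case/or4P=> [/eqP//|/eqP e|/eqP e|pe].
- by case: s3; rewrite !sgnE.
- by case: si; rewrite !sgnE.
(* For 4 <= i <= 7 the windows start at i-3 and i-2, between 1 and 5, and are among those evaluated
   for LSP_4. *)
have cc s : 0 < s < 6 -> check_component s 4 (code w).
  move=> s6; have /andP[_ /all_code/(_ w)/allP/(_ s)] := LSP4_check.
  by rewrite mem_iota /check_component => /(_ s6)/and3P[-> ->].
by rewrite !genfun_component ?(perm_big _ pe) //; apply: cc;
  rewrite subn_gt0 ltn_subLR ?(ltnW i4) ?(ltnW (ltnW i4)) ?i4 //= ltnW.
Qed.

(** * Failure of Schur positivity *)

Lemma schur_positive_coef n f z w : w <= z -> schur_positive n f ->
  ((f 2)@_(mon2 z.+1 w) <= (f 2)@_(mon2 z w.+1))%R.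
Proof.
move=> wz [c [data_check ->]]; rewrite !raddf_sum /=; apply: ler_sum => la la_part.
by rewrite !mcoeffZ ler_wpM2l // mcoeff_schur_le.
Qed.

Lemma not_schur_positive_Gstar : ~ graph_schur_positive Gstar.
Proof.
(* Exponents (5, 3) are compared with (4, 4); writing 3 as 8 - 5 and 4 as 8 - 4 matches the form in
   [fundamental_mon2]. *)
move=> /(@schur_positive_coef _ _ 4 (8 - 5) isT).
rewrite -[(8 - 5).+1]/(8 - 4).
have gE z : z <= 8 -> ((genfun Gstar [set: V] 2)@_(mon2 z (8 - z)) =
    (count (descents_within z) (iota 0 126))%:R :> int)%R.
  move=> z8; have pe : perm_eq [seq code v | v : V] (iota 0 126).
    apply: uniq_perm; rewrite ?iota_uniq //.
      by rewrite map_inj_uniq ?enum_uniq //; apply: code_inj.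
    move=> k; rewrite mem_iota /=; apply/mapP/idP => [[v _ ->]|/code_surj[v vk]].
      exact: code_lt.
    by exists v; rewrite ?mem_enum.
  rewrite -sum1_count -(perm_big _ pe) /= big_map big_enum_cond /= natr_sum.
  rewrite /genfun raddf_sum /= [RHS]big_mkcond /=.
  apply: eq_big => [v|v _]; first by rewrite inE.
  rewrite fundamental_mon2 // /descents_within.
  rewrite (eq_in_all (a2 := fun j => (j \in window_descents 1 8 (code v)) ==> (j == z))).
    by case: ifP.
  move=> j; rewrite mem_iota1 => j8; rewrite mem_filter mem_iota1 j8 andbT addn1 /=.
  by rewrite /des sgnE.
rewrite (gE 5 isT) (gE 4 isT) descents_within_count ler_nat ltnn; apply: notF.
Qed.

(** * Axioms 4''b and 4'b *)

Lemma string_adjP i (x : {w : 8.-tuple 'I_8 | w \in Wstar}) l :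
  reflect (exists2 v, edge Gstar (i - 2) x v || edge Gstar i.-1 x v & code v = l)
    (l \in string_adj i (code x)).
Proof.
rewrite /string_adj -(mem_map (@Some_inj _)) pmapS_filter; apply: (iffP mapP).
  case=> t; rewrite mem_filter => /andP[_ tin] tl.
  have [y yl _] := nbr_code (esym tl); exists y => //.
  by move: tin; rewrite !inE !edgeE => /orP[]/eqP <-; rewrite -tl yl eqxx ?orbT.
by case=> v /orP[]/eqP xv <-; [exists (i - 2) | exists i.-1] => //;
  rewrite mem_filter xv !inE eqxx ?orbT.
Qed.

Lemma axiom4''b_Gstar : axiom4''b Gstar.
Proof.
move=> i h x i37 [base link].
have i4 : i \in iota 4 4.
  by rewrite mem_iota; case/andP: i37 => a b; apply/andP; split; [exact: a | exact: b].
have /and4P[/allP Bsrc /all_code strcl /all_code Wpair /allP Bsucc] :=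
  allP axiom4''b_check _ i4.
have [x_inj x_adm x_edge] := base.
have admE k : 0 < k <= 2 * h -> isSome (nbr (i - 2) (code (x k))).
  by move=> /x_adm; rewrite admitsE.
have pairE m : 0 < m <= h -> nbr i (code (x (2 * m).-1)) = Some (code (x (2 * m))).
  by move=> /x_edge /E_Some /nbr_code[y _ [yE _]].
have in2h m : 0 < m <= h -> 0 < 2 * m <= 2 * h by rewrite leq_mul2l muln_gt0.
have in2h1 m : 0 < m <= h -> 0 < (2 * m).-1 <= 2 * h.
  by case: m => // m /andP[_ mh]; rewrite mulnS add2n /= ltn_mul2l.
have cand m : 0 < m <= h -> chain_candidate i (code (x (2 * m).-1)).
  move=> mh; rewrite /chain_candidate (pairE m mh); apply/and3P; split=> //.
    exact: (admE _ (in2h1 m mh)).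
  exact: (admE _ (in2h m mh)).
apply: (@chain_certificate _ _ _ _ _ _ (fun u => code u \in reach_from_nonW i) base).
- move=> u v /E_Some uv; rewrite !typeWE; have := Wpair u; rewrite uv.
  by move/(@eqP bool).
- move=> m mh; rewrite typeWE => nW.
  have := Bsrc (code (x (2 * m).-1)); rewrite mem_iota code_lt => /(_ isT)/implyP; apply.
  by apply/andP; split; [exact: cand | exact: nW].
(* By the evaluated stability of the bad set, it suffices that x^{2m+1} occurs in [chain_succ] of
   x^{2m-1}. *)
move=> m /andP[m0 mh] /Bsucc /allP H; rewrite !typeWE; apply: H.
have m1 : 0 < m <= h by rewrite m0 ltnW.
have xS : (2 * m.+1).-1 = (2 * m).+1 by rewrite mulnS.
have mS : 0 < (2 * m).+1 <= 2 * h by rewrite -xS in2h1.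
have [str [y yE Wy]] := link m ltac:(by rewrite m0).
have ne k : 0 < k <= 2 * h -> k != (2 * m).+1 -> code (x (2 * m).+1) != code (x k).
  by move=> kh kn; apply/eqP => /code_inj/(x_inj _ _ mS kh) e; rewrite e eqxx in kn.
rewrite /chain_succ (pairE m m1) mem_filter; apply/andP; split.
  apply/and4P; split.
  - by apply: (ne _ (in2h1 m m1)); rewrite neq_ltn (leq_ltn_trans (leq_pred _)).
  - by apply: (ne _ (in2h m m1)); rewrite neq_ltn ltnSn.
  - by have := cand m.+1 mh; rewrite xS.
  - by move/E_Some: yE => ->; rewrite -typeWE.
move: str; rewrite in_set; apply: (closed_list_connect (string_adjP i) (strcl _)).
by rewrite /string_list; apply: mem_reach; exact: mem_head.
Qed.

Lemma axiom4'b_Gstar : axiom4'b Gstar.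
Proof.
move=> i h x i37 /(flat_chain_weak axiom0_Gstar); exact: axiom4''b_Gstar.
Qed.

Theorem theorem1p5 :
  (exists (W : {set 8.-tuple 'I_8})
          (G : scgraph 8 {w : 8.-tuple 'I_8 | w \in W}),
     [/\ is_D0_graph G, axiom4''b G, axiom5 G & ~ graph_schur_positive G])
  /\
  ~ (forall (n : nat) (V : finType) (G : scgraph n V),
       is_D_graph G -> graph_schur_positive G).
Proof.
split.
  exists Wstar, Gstar; split; first exact: D0_Gstar.
  - exact: axiom4''b_Gstar.
  - exact: axiom5_Gstar.
  - exact: not_schur_positive_Gstar.
move=> /(_ _ _ Gstar) H; apply: not_schur_positive_Gstar; apply: H.
split; split.
- exact: axiom1_Gstar.
- exact: axiom2_Gstar.
- exact: axiom3_Gstar.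
- exact: axiom4'a_Gstar.
- exact: axiom4'b_Gstar.
- exact: axiom5_Gstar.
- exact: (LSP_Gstar LSP4_check).
- exact: (LSP_Gstar LSP5_check).
Qed.
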